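(* Uniformly for integers $n\ge3$, integers $j$ in the range \[ 1\le j\le\log n-\sqrt{(\log n)\log\log n} \] and any real $w$, \[ \mathbb{P}\Big(\log D_j(\sigma)\le j+w\sqrt{j}\Big)=\Phi(w)+O\left(\frac{\log(2j)}{\sqrt{j}}\right),\qquad\Phi(w)=\frac1{\sqrt{2\pi}}\int_{-\infty}^we^{-\frac12t^2}\,dt. \]
   Context: The probability $\mathbb{P}$ is with respect to a uniformly random permutation $\sigma$ in the symmetric group $\mathcal{S}_n$ on $\{1,\ldots,n\}$. $D_j(\sigma)$ is the length of the $j$-th smallest cycle of $\sigma$, i.e. the $j$-th term when the cycle lengths of $\sigma$ are listed in nondecreasing order with multiplicity (ties allowed; fixed points count as cycles of length 1). If $\sigma$ has fewer than $j$ cycles, then $D_j(\sigma)$ does not exist and the event $\log D_j(\sigma)\le j+w\sqrt j$ is regarded as not occurring. The constant implied by $O$ is absolute (independent of $n,j,w$). *)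

(* Defs.v *)
From HB Require Import structures.
From mathcomp Require Export all_boot all_order all_algebra all_fingroup.
From mathcomp Require Export all_classical all_reals all_analysis.

Set Implicit Arguments.
Unset Strict Implicit.
Unset Printing Implicit Defensive.

Import Order.TTheory GRing.Theory Num.Theory.
Import numFieldNormedType.Exports.

Local Open Scope classical_set_scope.
Local Open Scope ring_scope.

(* ['I_n] stands for {1, ..., n}; [porbits] includes the fixed points, as
   singleton orbits. *)
Definition cycle_lengths (n : nat) (s : 'S_n) : seq nat :=
  sort leq [seq #|c| | c : {set 'I_n} <- enum (porbits s)].

(* D_j, for 1 <= j (1-based); the value is the junk 0 when s has fewer than
   j cycles. *)
Definition nth_smallest_cycle (n j : nat) (s : 'S_n) : nat :=
  nth 0%N (cycle_lengths s) j.-1.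

Definition uniform_perm_prob (R : realType) (n : nat) (E : {pred 'S_n}) : R :=
  #|E|%:R / #|{: 'S_n}|%:R.

(* The event log D_j <= x, which does not occur when D_j does not exist. *)
Definition log_cycle_le (R : realType) (n j : nat) (x : R) : {pred 'S_n} :=
  fun s => (j <= size (cycle_lengths s))%N &&
           (ln (nth_smallest_cycle j s)%:R <= x).

Definition Phi (R : realType) (w : R) : R :=
  (Num.sqrt (2 * pi))^-1 *
  (\int[lebesgue_measure]_(t in [set` `]-oo, w]]) expR (- (t ^+ 2 / 2)))%R.

(* Main.v *)
From HB Require Import structures.
Require Import Defs.
From mathcomp Require Import ring lra zify.

Set Implicit Arguments.
Unset Strict Implicit.
Unset Printing Implicit Defensive.

Import Order.TTheory GRing.Theory Num.Theory.
Import numFieldNormedType.Exports.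
Local Open Scope ring_scope.

(** The [j]-th smallest cycle has length at most [m] exactly when the number [C]
of cycles of length at most [m] is at least [j].  For [m] small compared with
[n] the variable [C] is nearly Poisson of mean [h = 1 + 1/2 + ... + 1/m], and a
Poisson variable of mean [h] is at least [j] with the probability that a Gamma
variable of shape [j] is at most [h].  With [m] the integer part of [exp x] and
[x = j + w sqrt j], the mean [h] lies in [[x, x + 1]], and the Gamma variable,
of mean and variance [j], satisfies a central limit theorem with error
[O(1/sqrt j)].

Poisson approximation.  Removing from a permutation the cycle of a given element
gives a recursion in [n] for the binomial moments [E binom(C, r)].  It is solved
by the sum of the coefficients of degree at most [n] of the polynomial [T^r/r!],
where [T = sum_(l <= m) X^l/l] ([sum_binomial_small_cycles]).  Hence
[E binom(C, r) <= h^r/r!], with equality as soon as [r m <= n].  By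
inclusion-exclusion the indicator of [C > k] is a signed combination of the
[binom(C, i + 1)] with weights at most [2^i] in absolute value.  The truncation
of this combination at order [r] has an expectation which is a polynomial in
[h], and the same polynomial is, up to a similar error, the Gamma distribution
function at [h], through the Taylor polynomials of [exp (- t)]
([cycle_count_prob_gamma]).  The total error, [2^(1-r) exp (4 h)], is at most
[2/j] for [r = 25 j] and [h <= 3 j].

Central limit theorem for Gamma.  On [|u| <= U], with [U = sqrt (ln j) + 1], the
density of the standardized variable is [kappa phi(u) (1 + O((1 + u^4)/sqrt j))],
where [phi] is the Gaussian density and the constant [kappa] does not depend on
[u].  Since [(1 + u^4) phi(u)] has a bounded antiderivative, the increments of
the distribution function are those of [kappa Phi] up to [O(kappa/sqrt j)].
Chernoff bounds show that the mass outside [[-U, U]] is [O(1/sqrt j)], so that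
comparing the masses of [[-U, U]] yields [kappa = 1 + O(1/sqrt j)] without
Stirling's formula ([std_gamma_clt]).

Range of [w].  Put [l = sqrt (ln j)] and [w0 = l - 1/l].  The hypothesis on [j]
gives [ln n >= j + l sqrt j], so for [w <= w0] the ratio [n/m] is at least
[exp (sqrt j / l)], much more than the [25 j] required above
([prob_close_center]).  For [|w| > w0] monotonicity in [w] suffices, because the
Gaussian tail beyond [w0] is [O(exp (- w0^2/2)) = O(1/sqrt j)]; with a cutoff
at [l] the same estimate would only give [n/m >= 1].  The error obtained is thus
[O(1/sqrt j)], for [j] beyond an absolute constant; smaller [j] are absorbed in
the constant. *)

(** * Cycles of permutations *)

Section Cycles.
Variable T : finType.
Implicit Types (A B : {set T}) (s t : {perm T}).

(** The count is relative to a set [A] that the permutation preserves, so that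
removing a cycle from a permutation stays within one type: the permutations of
[A] are those of [T] with support in [A], and the points outside [A] are
discarded instead of counted as fixed points. *)
Definition small_cycles (m : nat) s A : nat :=
  #|[set c in porbits s | (c \subset A) && (#|c| <= m)%N]|.

Lemma porbit_step s x y : y \in porbit s x -> s y \in porbit s x.
Proof.
rewrite -!eq_porbit_mem => /eqP <-; rewrite eq_porbit_mem.
by have := mem_porbit s 1 y; rewrite expg1.
Qed.

Lemma porbit_invariant s A x : (forall y, y \in A -> s y \in A) ->
  x \in A -> porbit s x \subset A.
Proof.
move=> sA xA; apply/fintype.subsetP => y /porbitP[i ->].
by elim: i => [|i IHi]; rewrite ?expg0 ?perm1// expgSr permM sA.
Qed.

Lemma porbit_fixed s x : s x = x -> porbit s x = [set x].
Proof.
move=> sx; apply/eqP; rewrite finset.eqEsubset finset.sub1set porbit_id andbT.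
by apply: porbit_invariant; [move=> y /finset.set1P -> | ]; rewrite ?sx finset.set11.
Qed.

Lemma small_cycles_split m s A x : perm_on A s -> x \in A ->
  small_cycles m s A =
  ((#|porbit s x| <= m) + small_cycles m s (A :\: porbit s x))%N.
Proof.
move=> sA xA; rewrite /small_cycles (cardsD1 (porbit s x)) !inE.
have -> : porbit s x \in porbits s by apply: finset.imset_f.
rewrite (porbit_invariant _ xA) /=; last by move=> y yA; rewrite perm_closed.
congr (_ + #|pred_of_set _|)%N; apply/finset.setP => c; rewrite !inE.
rewrite andbCA; have [/imsetP[z _ ->]|//] := boolP (c \in porbits s).
rewrite /= andbA; congr (_ && _); rewrite finset.subsetD andbC; congr (_ && _).
rewrite eq_porbit_mem; apply/idP/idP => [zx|]; last first.
  by move=> /disjointFr -> //; rewrite porbit_id.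
rewrite disjoint_subset; apply/fintype.subsetP => y yz; rewrite inE.
apply: contra zx; rewrite -!eq_porbit_mem in yz *.
by move: yz => /eqP ->.
Qed.

(** [tperm x y * t] inserts the fixed point [y] of [t] just after [x] in the
cycle of [x].  Every permutation that moves [x] arises in this way, from a
unique [t], with [y] the image of [x]. *)
Section Insert.
Variables (t : {perm T}) (x y : T).
Hypotheses (neq_xy : x != y) (ty : t y = y).
Let s := (tperm x y * t)%g.

Let notin_y : y \notin porbit t x.
Proof. by rewrite porbit_sym porbit_fixed // inE. Qed.

Lemma porbit_insert : porbit s x = y |: porbit t x.
Proof.
have sx : s x = y by rewrite permM tpermL.
have sy : s y = t x by rewrite permM tpermR.
have sE z : z != x -> z != y -> s z = t z.
  by move=> zx zy; rewrite permM tpermD // eq_sym.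
apply/eqP; rewrite finset.eqEsubset; apply/andP; split.
  apply: porbit_invariant => [z|]; last by rewrite !inE porbit_id orbT.
  rewrite !inE; have [->|zy] /= := eqVneq z y.
    by move=> _; rewrite sy porbit_step ?porbit_id ?orbT.
  have [->|zx zt] := eqVneq z x; first by rewrite sx eqxx.
  by rewrite sE // porbit_step ?orbT.
rewrite finset.subUset finset.sub1set -{1}sx porbit_step ?porbit_id //=.
suff : porbit t x \subset porbit s x :&: porbit t x by rewrite finset.subsetI => /andP[].
apply: porbit_invariant => [z|]; last by rewrite inE !porbit_id.
rewrite !inE => /andP[zs zt]; rewrite (porbit_step zt) andbT.
have [->|zx] := eqVneq z x; first last.
  by rewrite -sE ?porbit_step //; apply: contraNneq notin_y => <-.
by rewrite -sy -sx; do 2! apply: porbit_step; rewrite porbit_id.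
Qed.

Lemma porbit_insertN z : z \notin porbit s x -> porbit s z = porbit t z.
Proof.
rewrite porbit_insert !inE negb_or => /andP[zy zx].
have E i : (s ^+ i)%g z = (t ^+ i)%g z.
  elim: i => [|i IHi]; first by rewrite !expg0.
  rewrite !expgSr !permM IHi tpermD //.
    by apply: contraNneq zx => ->; rewrite porbit_sym mem_porbit.
  apply: contraNneq zy => e; have : z \in porbit t y by rewrite e porbit_sym mem_porbit.
  by rewrite porbit_fixed // inE.
by apply/finset.setP => w; apply/porbitP/porbitP => -[i ->]; exists i; rewrite E.
Qed.

Lemma card_porbit_insert : #|porbit s x| = #|porbit t x|.+1.
Proof. by rewrite porbit_insert cardsU1 notin_y. Qed.

Lemma small_cycles_insert m A : y \in A ->
  small_cycles m s (A :\: porbit s x) =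
  small_cycles m t ((A :\ y) :\: porbit t x).
Proof.
move=> yA; have -> : (A :\ y) :\: porbit t x = A :\: porbit s x.
  by rewrite porbit_insert finset.setDDl.
congr #|pred_of_set _|; apply/finset.setP => c; rewrite !inE.
have [cA|] := boolP (c \subset A :\: porbit s x); rewrite ?andbF // !andTb.
congr (_ && _); have sub z : z \in c -> z \notin porbit s x.
  by move=> /(fintype.subsetP cA); rewrite inE => /andP[].
apply/imsetP/imsetP => -[z _ e]; exists z => //; rewrite e.
  by rewrite porbit_insertN // sub // e porbit_id.
by rewrite porbit_insertN // sub // e porbit_id.
Qed.

End Insert.

(** When [h a] is the mean of [f] over the permutations of [a] points, this says
that the cycle of [x] has length [k.+1] with probability [1/#|A|], and that the
rest is then a uniform permutation of the remaining points.  The induction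
shortens the cycle of [x] by taking out the image of [x], which can be any
point of [A :\ x]. *)
Lemma sum_porbit_size (R : realFieldType) (m n : nat) (f : nat -> R) (h : nat -> R) :
  (forall A, (#|A| < n)%N ->
     \sum_(s | perm_on A s) f (small_cycles m s A) = (#|A|)`!%:R * h #|A|) ->
  forall k A x, x \in A -> (#|A| <= n)%N -> (k < #|A|)%N ->
  \sum_(s | perm_on A s && (#|porbit s x| == k.+1))
     f (small_cycles m s (A :\: porbit s x)) =
  #|A|.-1`!%:R * h (#|A| - k.+1)%N.
Proof.
move=> IH; elim=> [|k IHk] A x xA An kA.
  have Ax : #|A :\ x| = #|A|.-1 by rewrite (cardsD1 x A) xA.
  rewrite subn1 -Ax -IH; last by rewrite Ax prednK.
  rewrite [LHS](eq_bigl (fun s => s \in perm_on (A :\ x))).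
    apply: eq_bigr => s sA; rewrite porbit_fixed //.
    by apply: (out_perm sA); rewrite !inE eqxx.
  move=> s; apply/andP/idP => [[sA /cards1P[z ez]]|sA].
    have /finset.set1P xz : x \in [set z] by rewrite -ez porbit_id.
    have sx : s x = x.
      by have := mem_porbit s 1 x; rewrite expg1 ez xz => /finset.set1P.
    apply/fintype.subsetP => w; rewrite !inE => sw; apply/andP; split.
      by apply: contraNneq sw => ->; rewrite sx.
    by apply: (fintype.subsetP sA); rewrite inE.
  split; last by rewrite porbit_fixed ?cards1 // (out_perm sA) // !inE eqxx.
  by apply: fintype.subset_trans sA _; rewrite finset.subsetDl.
rewrite (partition_big (fun s : {perm T} => s x) (mem (A :\ x))) /=; last first.
  move=> s /andP[sA /eqP sk]; rewrite !inE perm_closed // xA andbT.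
  by apply: contra_eqN sk => /eqP/porbit_fixed ->; rewrite cards1.
have Ax : #|A| = (#|A :\ x|).+1 by rewrite (cardsD1 x A) xA.
transitivity (\sum_(y in A :\ x) (#|A|.-2`!%:R * h (#|A| - k.+2)%N)); last first.
  rewrite sumr_const -[LHS]mulrnAl -mulrnA; congr (_%:R * _).
  by rewrite Ax; case: (#|A :\ x|) kA Ax => [|a] kA Ax;
    [move: kA; rewrite Ax | rewrite factS mulnC].
apply: eq_bigr => y; rewrite !inE => /andP[yx yA]; have xy : x != y by rewrite eq_sym.
have Ay : #|A :\ y| = #|A|.-1 by rewrite (cardsD1 y A) yA.
have -> : (#|A| - k.+2 = #|A :\ y| - k.+1)%N by rewrite Ay; case: (#|A|).
rewrite -Ay -(IHk _ x); first last.
- by rewrite Ay -ltnS prednK ?(leq_trans _ kA).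
- by rewrite Ay; apply: leq_trans An; rewrite leq_pred.
- by rewrite !inE eq_sym yx.
rewrite (reindex_onto (fun t => tperm x y * t)%g (fun s => tperm x y * s)%g) /=; last first.
  by move=> s _; rewrite mulgA tperm2 mul1g.
rewrite [LHS](eq_bigl (fun t => perm_on (A :\ y) t && (#|porbit t x| == k.+1))).
  apply: eq_bigr => t /andP[tA _]; rewrite small_cycles_insert // 1?eq_sym //.
  by apply: (out_perm tA); rewrite !inE eqxx.
move=> t; rewrite mulgA tperm2 mul1g eqxx andbT permM tpermL.
apply/idP/idP => [/andP[/andP[sA ks] /eqP ty]|/andP[tA kt]].
  rewrite (card_porbit_insert xy ty) eqSS in ks; rewrite ks andbT.
  apply/fintype.subsetP => z; rewrite !inE => tz.
  apply/andP; split; first by apply: contraNneq tz => ->; rewrite ty.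
  apply: contraNT tz => zA.
  have zx : x != z by apply: contraNneq zA => <-.
  have zy : y != z by apply: contraNneq zA => <-.
  by have := out_perm sA zA; rewrite permM tpermD // => ->.
have ty : t y = y by apply: (out_perm tA); rewrite !inE eqxx.
rewrite ty eqxx andbT (card_porbit_insert xy ty) eqSS kt andbT.
apply: perm_onM.
  apply: fintype.subset_trans (tperm_on x y) _; apply/fintype.subsetP => z; rewrite !inE.
  by case/orP => /eqP ->.
by apply: fintype.subset_trans tA _; rewrite finset.subsetDl.
Qed.

End Cycles.

(** * Binomial moments of the number of short cycles *)

Section Moments.
Variable R : realFieldType.
Implicit Types (p q : {poly R}) (m n r : nat).

(** The term of degree [0] vanishes, since the inverse of [0] is [0]. *)
Definition cycle_poly m : {poly R} := \poly_(l < m.+1) l%:R^-1.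

Definition harmonic_sum m : R := \sum_(1 <= l < m.+1) l%:R^-1.

(** Expanding the power shows that this is [1/r!] times the sum of the
[1/(l_1 ... l_r)] over the tuples of lengths [l_i <= m] of total at most [n]:
the mean number of sets of [r] cycles of length at most [m] in a uniform
permutation of [n] points. *)
Definition cycle_moment m r n : R :=
  (\sum_(l < n.+1) (cycle_poly m ^+ r)`_l) / r`!%:R.

(** Summation by parts: the difference of the first two sums counts the
coefficient of degree [l] exactly [l] times. *)
Lemma sum_coef_deriv p n :
  n.+1%:R * \sum_(l < n.+2) p`_l =
  \sum_(k < n.+1) (\sum_(l < k.+1) p`_l) + \sum_(l < n.+1) p^`()`_l.
Proof.
elim: n => [|n IHn].
  by rewrite !big_ord_recr !big_ord0 /= !add0r mul1r coef_deriv.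
rewrite big_ord_recr /= [in RHS]big_ord_recr /=.
rewrite [\sum_(l < n.+2) p^`()`_l]big_ord_recr /= coef_deriv.
have E : n.+2%:R = n.+1%:R + 1 :> R by rewrite natr1.
by rewrite addrACA -IHn -mulr_natl E; ring.
Qed.

Lemma sum_triangle (g : nat -> nat -> R) n :
  \sum_(l < n) \sum_(k < l.+1) g k (l - k)%N = \sum_(k < n) \sum_(l < n - k) g k l.
Proof.
elim: n => [|n IHn]; first by rewrite !big_ord0.
rewrite big_ord_recr /= IHn [RHS]big_ord_recr [in LHS]big_ord_recr /=.
rewrite addrA -big_split /= subSnn subnn big_ord1; congr (_ + _).
by apply: eq_bigr => k _; rewrite subSn ?big_ord_recr // ltnW.
Qed.

Lemma deriv_cycle_poly m k : (cycle_poly m)^`()`_k = (k < m)%:R.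
Proof.
rewrite coef_deriv coef_poly ltnS; case: ltnP => _; rewrite ?mul0rn //.
by rewrite -[LHS]mulr_natr mulVf // pnatr_eq0.
Qed.

(** The same recursion as for the binomial moments of the number of short cycles,
where [k.+1] is the length of the cycle of a given point.  It reflects that the
derivative of [T^(r+1)/(r+1)!] is [T^r/r! * (1 + X + ... + X^(m-1))]. *)
Lemma cycle_moment_rec m r n :
  n.+1%:R * cycle_moment m r.+1 n.+1 =
  \sum_(k < n.+1) (cycle_moment m r.+1 (n - k) + (k < m)%:R * cycle_moment m r (n - k)).
Proof.
rewrite /cycle_moment mulrA sum_coef_deriv mulrDl big_split /=; congr (_ + _).
  rewrite (reindex_inj rev_ord_inj) mulr_suml; apply: eq_bigr => k _ /=.
  by rewrite subSS.
rewrite deriv_exp /= factS natrM.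
under eq_bigr do rewrite -mulr_natr -polyC_natr coefMC mulrC.
rewrite -mulr_sumr -mulf_div divff ?pnatr_eq0 // mul1r.
rewrite (eq_bigr _ (fun (l : 'I_n.+1) _ => coefM _ _ l)).
rewrite (sum_triangle (fun k l => (cycle_poly m)^`()`_k * (cycle_poly m ^+ r)`_l)).
rewrite mulr_suml; apply: eq_bigr => k _; rewrite subSn -1?ltnS //.
by rewrite -mulr_sumr deriv_cycle_poly mulrA.
Qed.

Lemma cycle_polyX_ge0 m r l : 0 <= (cycle_poly m ^+ r)`_l.
Proof.
elim: r l => [|r IHr] l; first by rewrite expr0 coef1.
rewrite exprS coefM sumr_ge0 // => i _; rewrite mulr_ge0 // coef_poly.
by case: ifP => // _; rewrite invr_ge0.
Qed.

Lemma horner_cycle_poly m : (cycle_poly m).[1] = harmonic_sum m.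
Proof.
rewrite horner_poly /harmonic_sum -(big_mkord predT (fun l => l%:R^-1 * 1 ^+ l)).
rewrite big_nat_recl // mulr0n invr0 mul0r add0r big_add1 /=.
by apply: eq_bigr => i _; rewrite expr1n mulr1.
Qed.

Lemma cycle_moment_ge0 m r n : 0 <= cycle_moment m r n.
Proof. by rewrite divr_ge0 // sumr_ge0 // => l _; apply: cycle_polyX_ge0. Qed.

(** For [r * m <= n] all the coefficients of [T^r] are summed, which evaluates
[T^r] at [1]. *)
Lemma cycle_moment_eq m r n : (r * m <= n)%N ->
  cycle_moment m r n = harmonic_sum m ^+ r / r`!%:R.
Proof.
move=> rmn; rewrite /cycle_moment -horner_cycle_poly -horner_exp.
rewrite (@horner_coef_wide _ n.+1); last first.
  apply: leq_trans (size_poly_exp_leq _ _) _; rewrite ltnS.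
  apply: leq_trans rmn; rewrite mulnC leq_mul2l; apply/orP; right.
  by rewrite -subn1 leq_subLR add1n size_poly.
by congr (_ / _); apply: eq_bigr => i _; rewrite expr1n mulr1.
Qed.

Lemma cycle_moment_le m r n : cycle_moment m r n <= harmonic_sum m ^+ r / r`!%:R.
Proof.
rewrite -(@cycle_moment_eq m r (n + r * m)) ?leq_addl // /cycle_moment.
rewrite ler_pM2r ?invr_gt0 ?ltr0n ?fact_gt0 //.
rewrite -!(big_mkord predT (fun l => (cycle_poly m ^+ r)`_l)).
rewrite [leRHS](@big_cat_nat _ _ _ n.+1) //= ?ltnS ?leq_addr // lerDl.
by rewrite sumr_ge0 // => l _; apply: cycle_polyX_ge0.
Qed.

Lemma cycle_moment00 m r : cycle_moment m r 0 = 'C(0, r)%:R.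
Proof.
rewrite /cycle_moment big_ord1 -horner_coef0 horner_exp horner_coef0.
rewrite coef_poly /= invr0; case: r => [|r]; first by rewrite expr0 divr1.
by rewrite expr0n mul0r.
Qed.

Lemma cycle_moment0 m n : cycle_moment m 0 n = 1.
Proof. by rewrite cycle_moment_eq // expr0 divr1. Qed.

(** Conditioning on the length of the cycle of a point [x] of [A], and using the
Pascal rule when this cycle is itself short, gives [cycle_moment_rec]. *)
Lemma sum_binomial_small_cycles (T : finType) m r (A : {set T}) :
  \sum_(s | perm_on A s) 'C(small_cycles m s A, r)%:R =
  (#|A|)`!%:R * cycle_moment m r #|A|.
Proof.
have [n] := ubnP #|A|; elim: n => // n IHn in A r *; rewrite ltnS => An.
have [->|[x xA]] := finset.set_0Vmem A.
  rewrite cards0 mul1r cycle_moment00 (eq_bigr (fun=> 'C(0, r)%:R)).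
    by rewrite sumr_const card_perm cards0.
  move=> s _; congr 'C(_, r)%:R; apply: eq_card0 => c; rewrite !inE finset.subset0.
  apply/negP => /and3P[/imsetP[z _ ->] /eqP e _].
  by have := porbit_id s z; rewrite e inE.
case: r => [|r].
  rewrite cycle_moment0 mulr1 (eq_bigr (fun=> 1)); last by move=> s _; rewrite bin0.
  by rewrite sumr_const card_perm.
case EA : #|A| => [|N]; first by move: xA; rewrite (cards0_eq EA) inE.
rewrite factS natrM mulrAC cycle_moment_rec.
rewrite (partition_big (fun s : {perm T} => inord (#|porbit s x|.-1) : 'I_N.+1) predT) //=.
rewrite mulrC mulr_sumr; apply: eq_bigr => k _.
have sumE (q : nat) := @sum_porbit_size T R m #|A| (fun c => 'C(c, q)%:R)
  (fun j => cycle_moment m q j) (fun B BA => IHn B q (leq_trans BA An)) k A x xA (leqnn _).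
rewrite EA ltn_ord subSS /= in sumE.
rewrite mulrDr (mulrCA _ (k < m)%:R) -!sumE // mulr_sumr -big_split /=.
apply/esym/eq_big => [s|s].
  apply: andb_id2l => sA; apply/esym; rewrite -val_eqE /= inordK.
    by rewrite -eqSS prednK // lt0n card_porbit_neq0.
  rewrite -EA prednK ?lt0n ?card_porbit_neq0 // subset_leq_card //.
  by apply: porbit_invariant => // y yA; rewrite perm_closed.
move=> /andP[sA /eqP ks]; rewrite (small_cycles_split m sA xA) ks.
by case: ltnP => _; rewrite ?add0n ?mul0r ?addr0 // add1n binS natrD mul1r.
Qed.

End Moments.

(** * Gamma distribution functions and their Taylor polynomials *)

Section Calculus.
Variable R : realType.

(** The form in which the mean value theorem replaces integration below: an
estimate on densities becomes an estimate on increments. *)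
Lemma increment_le (f df g dg : R -> R) (a b : R) : a <= b ->
  (forall x, a <= x <= b -> is_derive x 1 f (df x)) ->
  (forall x, a <= x <= b -> is_derive x 1 g (dg x)) ->
  (forall x, a <= x <= b -> `|df x| <= dg x) ->
  `|f b - f a| <= g b - g a.
Proof.
move=> ab Df Dg le_df_dg.
have mono (h dh : R -> R) : (forall x, a <= x <= b -> is_derive x 1 h (dh x)) ->
    (forall x, a <= x <= b -> 0 <= dh x) -> h a <= h b.
  move=> Dh h0; have [x xab|x|c] := @MVT_segment R h dh a b ab.
  - by apply: Dh; rewrite !ltW ?(itvP xab).
  - apply: derivable_within_continuous => y yab.
    by apply: (@ex_derive _ _ _ _ _ _ _ (Dh y _)); rewrite ?(itvP yab).
  rewrite in_itv /= => cab hab; rewrite -subr_ge0 hab mulr_ge0 ?subr_ge0 //.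
  exact: h0.
rewrite ler_norml; apply/andP; split.
  have := mono (g \+ f) (dg \+ df); rewrite /= => H.
  suff : g a + f a <= g b + f b by lra.
  apply: H => x xab; first by have := Df x xab; have := Dg x xab; exact: is_deriveD.
  by have := le_df_dg x xab; rewrite ler_norml => /andP[]; lra.
have := mono (g \- f) (dg \- df); rewrite /= => H.
suff : g a - f a <= g b - f b by lra.
apply: H => x xab; first by have := Df x xab; have := Dg x xab; exact: is_deriveB.
by have := le_df_dg x xab; rewrite ler_norml => /andP[]; lra.
Qed.

Lemma is_derive_expRN (x : R) : is_derive x 1 (fun t => expR (- t)) (- expR (- x)).
Proof.
have D := is_derive1_comp (is_derive_expR (- x)) (is_deriveNid x 1).
by apply: (is_derive_eq D); rewrite mulrN1.
Qed.

Lemma expR_ge_sum (x : R) n : 0 <= x -> \sum_(i < n) x ^+ i / i`!%:R <= expR x.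
Proof.
move=> x0; rewrite -(big_mkord predT (fun i => x ^+ i / i`!%:R)).
apply: (nondecreasing_cvgn_le _ (@is_cvg_series_exp_coeff R x)).
by apply/nondecreasing_seqP => k; rewrite /series /= big_nat_recr //= lerDl exp_coeff_ge0.
Qed.

End Calculus.

Lemma bin_le_exp2 n k : ('C(n, k) <= 2 ^ n)%N.
Proof.
elim: n k => [|n IHn] [|k] //; first by rewrite bin0 expn_gt0.
by rewrite binS expnS mul2n -addnn leq_add.
Qed.

Section Gamma.
Variable R : realType.

Definition exp_poly n : {poly R} := \poly_(i < n) i`!%:R^-1.

Lemma deriv_exp_poly n : (exp_poly n.+1)^`() = exp_poly n.
Proof.
apply/polyP => i; rewrite coef_deriv !coef_poly ltnS; case: ifP => _; rewrite ?mul0rn //.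
by rewrite -[LHS]mulr_natl factS natrM invfM mulrA divff ?mul1r // pnatr_eq0.
Qed.

(** For [j > 0], the distribution function at [x] of a Gamma variable of shape
[j], given by its closed form: the probability that a Poisson variable of mean
[x] is at least [j]. *)
Definition gamma_cdf j (x : R) : R := 1 - expR (- x) * (exp_poly j).[x].

Lemma is_derive_gamma_cdf k (x : R) :
  is_derive x 1 (gamma_cdf k.+1) (expR (- x) * x ^+ k / k`!%:R).
Proof.
have D1 := is_derive_expRN x; have D2 := is_derive_poly (exp_poly k.+1) x.
have D0 : is_derive x 1 (cst 1 : R -> R) 0 by exact: is_derive_cst.
have D3 := is_deriveB D0 (is_deriveM D1 D2).
apply: (is_derive_eq D3); rewrite deriv_exp_poly.
have -> : (exp_poly k.+1).[x] = (exp_poly k).[x] + x ^+ k / k`!%:R.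
  by rewrite !horner_poly big_ord_recr /= [in X in _ + X]mulrC.
by rewrite /GRing.scale /=; ring.
Qed.

Lemma gamma_cdf0 k : gamma_cdf k.+1 0 = 0.
Proof.
by rewrite /gamma_cdf oppr0 expR0 mul1r horner_coef0 coef_poly /= invr1 subrr.
Qed.

Lemma gamma_cdf_homo k (x y : R) : 0 <= x -> x <= y ->
  gamma_cdf k.+1 x <= gamma_cdf k.+1 y.
Proof.
move=> x0 xy; rewrite -subr_ge0 (le_trans (normr_ge0 (x - x))) //.
have := @increment_le R (cst 0) (cst 0) (gamma_cdf k.+1)
  (fun x => expR (- x) * x ^+ k / k`!%:R) x y xy.
rewrite !subrr; apply => z; rewrite /= => zxy.
- exact: is_derive_gamma_cdf.
by rewrite normr0 divr_ge0 // mulr_ge0 ?expR_ge0 ?exprn_ge0 //; lra.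
Qed.

Lemma gamma_cdf_le1 j (x : R) : 0 <= x -> gamma_cdf j x <= 1.
Proof.
move=> x0; rewrite gerBl mulr_ge0 ?expR_ge0 // horner_poly sumr_ge0 // => i _.
by rewrite mulr_ge0 ?invr_ge0 ?exprn_ge0.
Qed.

Definition expN_poly n : {poly R} := \poly_(i < n) ((-1) ^+ i / i`!%:R).

Lemma deriv_expN_poly n : (expN_poly n.+1)^`() = - expN_poly n.
Proof.
apply/polyP => i; rewrite coefN coef_deriv !coef_poly ltnS; case: ifP => _.
  rewrite -[LHS]mulr_natl factS natrM invfM mulrCA mulVKf ?pnatr_eq0 //.
  by rewrite exprS mulN1r mulNr.
by rewrite mul0rn oppr0.
Qed.

Lemma is_derive_pow_fact n (x : R) :
  is_derive x 1 (fun t => t ^+ n.+1 / n.+1`!%:R) (x ^+ n / n`!%:R).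
Proof.
have D := is_derive_poly (n.+1`!%:R^-1 *: 'X^(n.+1)) x.
have E : horner (n.+1`!%:R^-1 *: 'X^(n.+1)) = (fun t : R => t ^+ n.+1 / n.+1`!%:R).
  by apply/funext => t; rewrite hornerZ hornerXn mulrC.
rewrite E in D; apply: (is_derive_eq D).
rewrite derivZ derivXn hornerZ hornerMn hornerXn /= factS natrM invfM.
rewrite -[in LHS](mulr_natl (x ^+ n)) mulrACA mulVf ?pnatr_eq0 //.
by rewrite mul1r mulrC.
Qed.

(** Each order follows from the preceding one, as the derivative of a remainder
is, up to sign, the preceding remainder. *)
Lemma expRN_approx n (x : R) : 0 <= x ->
  `|expR (- x) - (expN_poly n).[x]| <= x ^+ n / n`!%:R.
Proof.
elim: n x => [|n IHn] x x0.
  rewrite /expN_poly poly_def big_ord0 horner0 subr0 expr0 divr1.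
  by rewrite ger0_norm ?expR_ge0 // -expR0 ler_expR; lra.
have := @increment_le R (fun t => expR (- t) - (expN_poly n.+1).[t])
  (fun t => - (expR (- t) - (expN_poly n).[t]))
  (fun t => t ^+ n.+1 / n.+1`!%:R) (fun t => t ^+ n / n`!%:R) 0 x x0.
rewrite oppr0 expR0 horner_coef0 coef_poly /= expr0 invr1 mulr1 subrr subr0.
rewrite expr0n mul0r subr0; apply => t /andP[t0 _].
- have D := is_deriveB (is_derive_expRN t) (is_derive_poly (expN_poly n.+1) t).
  apply: (is_derive_eq D); rewrite deriv_expN_poly hornerN; ring.
- exact: is_derive_pow_fact.
by rewrite normrN IHn.
Qed.

(** The coefficients of inclusion-exclusion: the indicator of [k < c] is the sum
over [i] of [sieve_coef k i * 'C(c, i.+1)]. *)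
Definition sieve_coef k i : R := (-1) ^+ (i + k) * 'C(i, k)%:R.

(** Truncated inclusion-exclusion applied to a variable whose binomial moment of
order [i] is [x^i/i!], as for the Poisson law of mean [x]. *)
Definition sieve_poly k r : {poly R} :=
  \poly_(i < r.+1) (if i is l.+1 then sieve_coef k l / l.+1`!%:R else 0).

Lemma horner_sieve_poly k r x :
  (sieve_poly k r).[x] = \sum_(i < r) sieve_coef k i * (x ^+ i.+1 / i.+1`!%:R).
Proof.
rewrite horner_poly big_ord_recl mul0r add0r; apply: eq_bigr => i _ /=.
by rewrite -mulrA [_^-1 * _]mulrC.
Qed.

Lemma deriv_sieve_poly k r : (k <= r)%N ->
  (sieve_poly k r)^`() = k`!%:R^-1 *: ('X^k * expN_poly (r - k)).
Proof.
move=> kr; apply/polyP => i; rewrite coef_deriv coef_poly coefZ coefXnM coef_poly ltnS.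
rewrite /sieve_coef; case: (ltnP i k) => ik.
  by rewrite bin_small // mulr0n !(mulr0, mul0r, mul0rn) if_same mul0rn.
have -> : (i - k < r - k)%N = (i < r)%N by lia.
case: ifP => _; last by rewrite mul0rn mulr0.
rewrite -[LHS]mulr_natl factS natrM invfM.
have -> : (i + k = (i - k) + 2 * k)%N by lia.
rewrite exprD exprM sqrrN !expr1n mulr1 -(bin_fact ik) !natrM.
have i1 : (i.+1)%:R != 0 :> R by rewrite pnatr_eq0.
have ck : 'C(i, k)%:R != 0 :> R by rewrite pnatr_eq0 -lt0n bin_gt0.
have f1 : k`!%:R != 0 :> R by rewrite pnatr_eq0 -lt0n fact_gt0.
have f2 : (i - k)`!%:R != 0 :> R by rewrite pnatr_eq0 -lt0n fact_gt0.
by field; rewrite f2 f1 ck nat1r.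
Qed.

(** The derivative of [sieve_poly] is the Gamma density with [exp (- t)] replaced
by its Taylor polynomial of [r - k] terms. *)
Lemma gamma_cdf_sieve k r (x : R) : 0 <= x -> (k <= r)%N ->
  `|gamma_cdf k.+1 x - (sieve_poly k r).[x]| <= 2 ^+ r * (x ^+ r.+1 / r.+1`!%:R).
Proof.
move=> x0 kr.
have := @increment_le R (fun t => gamma_cdf k.+1 t - (sieve_poly k r).[t])
  (fun t => expR (- t) * t ^+ k / k`!%:R -
    (k`!%:R^-1 * (t ^+ k * (expN_poly (r - k)).[t])))
  (fun t => 2 ^+ r * (t ^+ r.+1 / r.+1`!%:R)) (fun t => 2 ^+ r * (t ^+ r / r`!%:R)) 0 x x0.
rewrite gamma_cdf0 horner_coef0 coef_poly /= !subr0 expr0n mul0r mulr0 subr0.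
apply => t /andP[t0 _].
- have D := is_deriveB (is_derive_gamma_cdf k t) (is_derive_poly (sieve_poly k r) t).
  by apply: (is_derive_eq D); rewrite deriv_sieve_poly // hornerZ hornerM hornerXn.
- exact: (is_deriveZ _ (is_derive_pow_fact r t)).
have -> : expR (- t) * t ^+ k / k`!%:R - (k`!%:R^-1 * (t ^+ k * (expN_poly (r - k)).[t]))
  = t ^+ k / k`!%:R * (expR (- t) - (expN_poly (r - k)).[t]) by ring.
rewrite normrM ger0_norm; last by rewrite divr_ge0 ?exprn_ge0.
apply: le_trans (ler_wpM2l _ (expRN_approx (r - k) t0)) _.
  by rewrite divr_ge0 ?exprn_ge0.
rewrite mulf_div -exprD subnKC // mulrCA ler_wpM2l ?exprn_ge0 //.
rewrite ler_pdivlMr ?ltr0n ?fact_gt0 // -(bin_fact kr) !natrM mulrCA mulVf ?mulr1.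
  by rewrite -natrX ler_nat bin_le_exp2.
by rewrite mulf_neq0 // pnatr_eq0 -lt0n fact_gt0.
Qed.

End Gamma.

(** * Inclusion-exclusion and Poisson approximation *)

Section Sieve.
Variable R : realType.

(** Binomial inversion.  The Pascal rule for both binomials turns the sum for
[(k.+1, c.+1)] into the sum for [(k, c)]. *)
Lemma sum_sieve_coef_bin k c N : (c < N)%N ->
  \sum_(i < N) sieve_coef R k i * 'C(c, i)%:R = (c == k)%:R.
Proof.
have S0 k' c' N' : \sum_(i < N'.+1) sieve_coef R k' i * 'C(c'.+1, i)%:R =
    \sum_(i < N'.+1) sieve_coef R k' i * 'C(c', i)%:R
    + \sum_(i < N') sieve_coef R k' i.+1 * 'C(c', i)%:R.
  rewrite !big_ord_recl /= !bin0 -addrA -big_split /=; congr (_ + _).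
  by apply: eq_bigr => i _; rewrite binS natrD mulrDr.
have top k' c' N' : (c' < N')%N -> \sum_(i < N'.+1) sieve_coef R k' i * 'C(c', i)%:R
    = \sum_(i < N') sieve_coef R k' i * 'C(c', i)%:R.
  by move=> cN; rewrite big_ord_recr /= (@bin_small c') // mulr0 addr0.
elim: c k N => [|c IHc] k [|N] // cN.
  rewrite big_ord_recl /= bin0 mulr1 big1 => [|i _]; last by rewrite bin0n mulr0.
  by rewrite addr0 /sieve_coef; case: k => [|k]; rewrite ?bin0 ?bin0n ?mulr0 ?mul1r.
rewrite S0 top //; case: k => [|k].
  rewrite -big_split /= big1 // => i _.
  by rewrite /sieve_coef !bin0 !addn0 exprS mulN1r; lra.
have E i : sieve_coef R k.+1 i.+1 = sieve_coef R k i - sieve_coef R k.+1 i.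
  rewrite /sieve_coef binS natrD addSn addnS !exprS; ring.
rewrite -big_split /= -(IHc k N) //; apply: eq_bigr => i _.
by rewrite E; ring.
Qed.

Lemma indicator_sieve k c N : (c <= N)%N ->
  (k < c)%N%:R = \sum_(i < N) sieve_coef R k i * 'C(c, i.+1)%:R.
Proof.
elim: c => [|c IHc] cN; first by rewrite big1 // => i _; rewrite bin0n mulr0.
rewrite (_ : (k < c.+1)%N%:R = (k < c)%N%:R + (c == k)%:R :> R); last first.
  by rewrite ltnS leq_eqVlt eq_sym; case: ltngtP => _; rewrite /= ?addr0 ?add0r.
rewrite IHc ?(ltnW cN) // -(sum_sieve_coef_bin k cN) -big_split /=.
by apply: eq_bigr => i _; rewrite binS natrD mulrDr.
Qed.

Definition cycle_count_prob n m (k : nat) : R :=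
  (\sum_(s : 'S_n) (k < small_cycles m s [set: 'I_n])%N%:R) / n`!%:R.

Lemma small_cycles_le n m (s : 'S_n) : (small_cycles m s [set: 'I_n] <= n)%N.
Proof.
apply: (@leq_trans #|porbits s|).
  by apply: subset_leq_card; apply/fintype.subsetP => c; rewrite inE => /andP[].
by rewrite (leq_trans (leq_imset_card _ _)) // card_ord.
Qed.

Lemma mean_binomial_small_cycles n m r :
  (\sum_(s : 'S_n) 'C(small_cycles m s [set: 'I_n], r)%:R) / n`!%:R = cycle_moment R m r n.
Proof.
have := sum_binomial_small_cycles R m r [set: 'I_n].
rewrite cardsT card_ord (eq_bigl predT) => [->|s]; last first.
  by rewrite /perm_on; apply/fintype.subsetP => x _; rewrite inE.
by rewrite mulrAC divff ?mul1r // pnatr_eq0 -lt0n fact_gt0.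
Qed.

Lemma cycle_count_prob_sieve n m k N : (n <= N)%N ->
  cycle_count_prob n m k = \sum_(i < N) sieve_coef R k i * cycle_moment R m i.+1 n.
Proof.
move=> nN; rewrite /cycle_count_prob.
under eq_bigr => s _ do
  rewrite (indicator_sieve k (leq_trans (small_cycles_le m s) nN)).
rewrite exchange_big /= mulr_suml; apply: eq_bigr => i _.
by rewrite -mulr_sumr -mulrA mean_binomial_small_cycles.
Qed.

Lemma normr_sieve_coef k i : `|sieve_coef R k i| <= 2 ^+ i.
Proof.
by rewrite /sieve_coef normrM normrX normrN1 expr1n mul1r normr_nat -natrX ler_nat bin_le_exp2.
Qed.

Lemma harmonic_sum_ge0 m : 0 <= harmonic_sum R m.
Proof. by rewrite sumr_ge0 // => i _; rewrite invr_ge0. Qed.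

(** Truncation at order [r] costs at most the sum of [2^i h^(i+1)/(i+1)!] over
[i >= r], on the side of the permutations as on the side of the Gamma law.  It
is bounded by extracting [2^(-r)] from the exponential series at [4 h]. *)
Lemma cycle_count_prob_gamma n m k r : (r * m <= n)%N -> (k <= r)%N ->
  `|cycle_count_prob n m k - gamma_cdf k.+1 (harmonic_sum R m)|
     <= 2 * (2 ^- r * expR (4 * harmonic_sum R m)).
Proof.
move=> rmn kr; set h := harmonic_sum R m; have h0 : 0 <= h := harmonic_sum_ge0 m.
have tail N : \sum_(r <= i < N) 2 ^+ i * (h ^+ i.+1 / i.+1`!%:R) <= 2 ^- r * expR (4 * h).
  apply: le_trans (ler_wpM2l _ (@expR_ge_sum R (4 * h) N.+1 _)); last 2 first.
  - by rewrite invr_ge0 exprn_ge0.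
  - by rewrite mulr_ge0.
  rewrite mulr_sumr big_ord_recl /=.
  rewrite -[leLHS]add0r lerD //; first by rewrite mulr_ge0 // ?invr_ge0 ?exprn_ge0 // expr0 divr_ge0.
  (* For [i >= r], [2 ^ i * h ^ i.+1 <= 2 ^- r * (4 * h) ^ i.+1]. *)
  rewrite -(big_mkord predT (fun i => 2 ^- r * ((4 * h) ^+ i.+1 / i.+1`!%:R))).
  have F i : 0 <= 2 ^- r * ((4 * h) ^+ i.+1 / i.+1`!%:R).
    by rewrite mulr_ge0 ?invr_ge0 ?exprn_ge0 // divr_ge0 // exprn_ge0 // mulr_ge0.
  case: (leqP r N) => rN; last by rewrite big_geq ?sumr_ge0 // ltnW.
  rewrite [leRHS](@big_cat_nat _ _ _ r) //= -[leLHS]add0r lerD ?sumr_ge0 //.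
  rewrite big_nat_cond [leRHS]big_nat_cond; apply: ler_sum => i /andP[/andP[ri _] _].
  rewrite !exprMn !mulrA ler_wpM2r ?invr_ge0 // ler_wpM2r ?exprn_ge0 //.
  rewrite ler_pdivlMl ?exprn_gt0 // -exprD (_ : 4 = 2 ^+ 2 :> R) -?exprM; last by ring.
  by rewrite ler_eXn2l ?ltr1n //; lia.
rewrite (@cycle_count_prob_sieve n m k (n + r)) ?leq_addr //.
rewrite -(big_mkord predT (fun i => sieve_coef R k i * cycle_moment R m i.+1 n)).
rewrite (@big_cat_nat _ _ _ r) ?leq_addl //=.
have -> : \sum_(0 <= i < r) sieve_coef R k i * cycle_moment R m i.+1 n = (sieve_poly R k r).[h].
  rewrite horner_sieve_poly big_mkord; apply: eq_bigr => i _; rewrite cycle_moment_eq //.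
  by apply: leq_trans rmn; rewrite leq_mul2r ltn_ord orbT.
have G := gamma_cdf_sieve h0 kr.
have T1 := tail r.+1; rewrite big_nat1 in T1.
have T2 := tail (n + r)%N.
have S : `|\sum_(r <= i < n + r) sieve_coef R k i * cycle_moment R m i.+1 n| <= 2 ^- r * expR (4 * h).
  apply: le_trans T2; apply: le_trans (ler_norm_sum _ _ _) _.
  apply: ler_sum => i _; rewrite normrM ler_pM // ?normr_sieve_coef //.
  by rewrite ger0_norm ?cycle_moment_ge0 // cycle_moment_le.
move: G S; rewrite distrC !ler_norml => /andP[? ?] /andP[? ?]; apply/andP; split; lra.
Qed.

(** The square root of [e] is at most [2], because [exp (-1/2) >= 1/2]. *)
Lemma expR_le4 : expR 1 <= 4 :> R.
Proof.
have -> : 1 = 2^-1 + 2^-1 :> R by lra.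
have h : 2^-1 <= expR (- 2^-1) :> R by apply: le_trans (expR_ge1Dx _); lra.
rewrite expRD; move: h; rewrite expRN => h.
have e0 := expR_gt0 (2^-1 : R).
have : expR 2^-1 <= 2 :> R by rewrite -lef_pV2 // ?posrE.
nra.
Qed.

End Sieve.

(** * The Gaussian distribution function *)

Section Gauss.
Variable R : realType.
Local Notation mu := lebesgue_measure.

Definition gauss_pdf (t : R) : R := (Num.sqrt (2 * pi))^-1 * expR (- (t ^+ 2 / 2)).

Lemma gauss_pdfE : gauss_pdf = normal_pdf 0 1.
Proof.
rewrite normal_pdfE ?oner_neq0 //; apply/funext => t.
rewrite /gauss_pdf /normal_peak /normal_fun subr0 expr1n mul1r mulNr.
by rewrite -[pi *+ 2]mulr_natl.
Qed.

Lemma sqrt2pi_gt0 : 0 < Num.sqrt (2 * pi) :> R.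
Proof. by rewrite sqrtr_gt0 mulr_gt0 ?pi_gt0. Qed.

Lemma gauss_pdf_ge0 t : 0 <= gauss_pdf t.
Proof. by rewrite mulr_ge0 ?expR_ge0 // invr_ge0 ltW // sqrt2pi_gt0. Qed.

Lemma gauss_pdf_le t : gauss_pdf t <= expR (- (t ^+ 2 / 2)).
Proof.
rewrite ler_piMl ?expR_ge0 // invf_le1 ?sqrt2pi_gt0 //.
rewrite -[X in X <= _]sqrtr1 ler_sqrt.
  by have := @pi_ge2 R; lra.
by rewrite mulr_ge0 ?pi_ge0.
Qed.

Lemma gauss_pdfN t : gauss_pdf (- t) = gauss_pdf t.
Proof. by rewrite /gauss_pdf sqrrN. Qed.

Lemma integrable_gauss_pdf D : measurable D -> mu.-integrable D (EFin \o gauss_pdf).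
Proof.
move=> mD; apply: (integrableS measurableT mD) => //.
by rewrite gauss_pdfE; exact: integrable_normal_pdf.
Qed.

Lemma PhiE (w : R) : Phi w = (\int[mu]_(t in [set` `]-oo, w]]) gauss_pdf t)%R.
Proof.
have E : (fun t => expR (- (t ^+ 2 / 2))) = (fun t => Num.sqrt (2 * pi) * gauss_pdf t).
  by apply/funext => t; rewrite /gauss_pdf mulVKf // gt_eqF // sqrt2pi_gt0.
rewrite /Phi E RintegralZl ?integrable_gauss_pdf //.
by rewrite mulKf // gt_eqF // sqrt2pi_gt0.
Qed.

Lemma Phi_normal_prob (w : R) : (Phi w)%:E = normal_prob 0 1 [set` `]-oo, w]].
Proof.
rewrite PhiE /Rintegral fineK; first by rewrite gauss_pdfE.
by apply: integrable_fin_num => //; exact: integrable_gauss_pdf.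
Qed.

Lemma is_derive_Phi (w : R) : is_derive w 1 (@Phi R) (gauss_pdf w).
Proof.
have [||||D1 D2] := @continuous_FTC1 R gauss_pdf -oo%O w (w + 1).
- by rewrite ltrDl.
- exact: integrable_gauss_pdf.
- by rewrite ltNyr.
- by rewrite gauss_pdfE; apply: continuous_normal_pdf; rewrite oner_neq0.
have E : (fun x => \int[mu]_(t in [set` `]-oo, x]]) gauss_pdf t)%R = @Phi R.
  by apply/funext => x; rewrite PhiE.
rewrite E in D1 D2.
apply: DeriveDef; first exact: D1.
by rewrite -derive1E; exact: D2.
Qed.

Let idm : measurableTypeR R -> R := idfun.
HB.instance Definition _ :=
  @isMeasurableFun.Build _ _ _ _ idm (@measurable_id _ _ setT).

Let cdfE : cdf (idm : {RV (normal_prob 0 1) >-> R}) = EFin \o @Phi R.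
Proof. by apply/funext => w; rewrite /= Phi_normal_prob. Qed.

Lemma cvg_Phi_y : (@Phi R x @[x --> +oo] --> (1:R))%classic.
Proof.
have := cvg_cdfy1 (idm : {RV (normal_prob 0 1) >-> R}).
by rewrite cdfE => /fine_cvgP[].
Qed.

Lemma cvg_Phi_Ny : (@Phi R x @[x --> -oo] --> (0:R))%classic.
Proof.
have := cvg_cdfNy0 (idm : {RV (normal_prob 0 1) >-> R}).
by rewrite cdfE => /fine_cvgP[].
Qed.

Lemma Phi_homo : {homo @Phi R : x y / x <= y}.
Proof.
move=> x y xy; rewrite -lee_fin !Phi_normal_prob le_measure ?inE //.
exact: subitvPr.
Qed.

Lemma Phi_ge0 w : 0 <= @Phi R w.
Proof. by rewrite -lee_fin Phi_normal_prob. Qed.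

Lemma Phi_le1 w : @Phi R w <= 1.
Proof. by rewrite -lee_fin Phi_normal_prob probability_le1. Qed.

Lemma is_derive_gauss_pdf (t : R) : is_derive t 1 gauss_pdf (- (t * gauss_pdf t)).
Proof.
have D1 := is_derive_poly (- 2^-1 *: 'X^2 : {poly R}) t.
have D2 := is_derive1_comp (is_derive_expR _) D1.
have D3 := is_deriveZ (Num.sqrt (2 * pi))^-1 D2.
have E : gauss_pdf = (Num.sqrt (2 * pi))^-1 *: (expR \o horner (- 2^-1 *: 'X^2 : {poly R})).
  apply/funext => x; rewrite /gauss_pdf /=; congr (_ * expR _).
  by rewrite hornerZ hornerXn mulNr mulrC.
rewrite E; apply: (is_derive_eq D3).
rewrite derivZ derivXn !(hornerZ, hornerMn, hornerXn) /= expr1.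
rewrite [in RHS]/GRing.scale /= hornerZ hornerXn.
by rewrite /GRing.scale /= -[t *+ 2]mulr_natl; field; rewrite gt_eqF ?sqrt2pi_gt0.
Qed.

(** [Phi + gauss_pdf] is nonincreasing on [[1, +oo[] and tends to [1]. *)
Lemma Phi_tail_right u : 1 <= u -> 1 - gauss_pdf u <= @Phi R u.
Proof.
move=> u1; rewrite lerBlDr; apply: (cvgr_to_le cvg_Phi_y).
near=> v; have uv : u <= v by near: v; apply: nbhs_pinfty_ge; exact: num_real.
have := @increment_le R (@Phi R) gauss_pdf (fun t => - gauss_pdf t)
  (fun t => t * gauss_pdf t) u v uv.
suff H : `|Phi v - Phi u| <= - gauss_pdf v - - gauss_pdf u ->
    Phi v <= Phi u + gauss_pdf u.
  move=> K; apply: H; apply: K => t /andP[ut _].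
  - exact: is_derive_Phi.
  - by apply: is_derive_eq (is_deriveN (is_derive_gauss_pdf t)) _; rewrite opprK.
  - rewrite ger0_norm ?gauss_pdf_ge0 // ler_peMl ?gauss_pdf_ge0 //; lra.
have := gauss_pdf_ge0 v; rewrite ler_norml => v0 /andP[]; lra.
Unshelve. all: by end_near. Qed.

(** [Phi - gauss_pdf] is nonincreasing on []-oo, -1]] and tends to [0]. *)
Lemma Phi_tail_left u : 1 <= u -> @Phi R (- u) <= gauss_pdf u.
Proof.
move=> u1; rewrite -subr_le0; apply: (cvgr_to_ge cvg_Phi_Ny).
near=> v; have vu : v <= - u by near: v; apply: nbhs_ninfty_le; exact: num_real.
have := @increment_le R (@Phi R) gauss_pdf gauss_pdf (fun t => - (t * gauss_pdf t)) v (- u) vu.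
suff H : `|Phi (- u) - Phi v| <= gauss_pdf (- u) - gauss_pdf v ->
    Phi (- u) - gauss_pdf u <= Phi v.
  move=> K; apply: H; apply: K => t /andP[_ tu].
  - exact: is_derive_Phi.
  - exact: is_derive_gauss_pdf.
  - rewrite ger0_norm ?gauss_pdf_ge0 // -mulNr ler_peMl ?gauss_pdf_ge0 //; lra.
have := gauss_pdf_ge0 v; rewrite gauss_pdfN ler_norml => v0 /andP[]; lra.
Unshelve. all: by end_near. Qed.

Lemma gauss_pdf_le1 t : gauss_pdf t <= 1.
Proof.
apply: le_trans (gauss_pdf_le t) _.
by rewrite -expR0 ler_expR oppr_le0 divr_ge0 ?sqr_ge0.
Qed.

Lemma Phi_lip (x y : R) : x <= y -> Phi y <= Phi x + (y - x).
Proof.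
move=> xy; have := @increment_le R (@Phi R) gauss_pdf id (fun=> 1) x y xy.
move=> H; suff : `|Phi y - Phi x| <= y - x by rewrite ler_norml => /andP[]; lra.
apply: H => t _; first exact: is_derive_Phi.
by rewrite ger0_norm ?gauss_pdf_ge0 ?gauss_pdf_le1.
Qed.

End Gauss.

(** * Logarithm, exponential and Gamma tails *)

Section Estimates.
Variable R : realType.

Lemma increment_le0 (f df g dg : R -> R) (r x : R) : `|x| <= r ->
  f 0 = 0 -> g 0 = 0 ->
  (forall t : R, `|t| <= r -> is_derive t 1 f (df t)) ->
  (forall t : R, `|t| <= r -> is_derive t 1 g (dg t)) ->
  (forall t : R, `|t| <= r -> `|df t| <= dg t) ->
  `|f x| <= `|g x|.
Proof.
rewrite ler_norml => /andP[xr1 xr2] f0 g0 Df Dg le_df.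
case: (lerP 0 x) => x0.
  have H := @increment_le R f df g dg 0 x x0; rewrite f0 g0 !subr0 in H.
  apply: le_trans (ler_norm (g x)); apply: H => t /andP[t1 t2].
  - by apply: Df; rewrite ger0_norm //; lra.
  - by apply: Dg; rewrite ger0_norm //; lra.
  - by apply: le_df; rewrite ger0_norm //; lra.
have H := @increment_le R f df g dg x 0 (ltW x0); rewrite f0 g0 !sub0r normrN in H.
rewrite -[`|g x|]normrN; apply: le_trans (ler_norm (- g x)); apply: H => t /andP[t1 t2].
- by apply: Df; rewrite ler0_norm //; lra.
- by apply: Dg; rewrite ler0_norm //; lra.
- by apply: le_df; rewrite ler0_norm //; lra.
Qed.

Lemma is_derive_ln1D (t : R) : -1 < t -> is_derive t 1 (fun t => ln (1 + t)) (1 + t)^-1.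
Proof.
move=> t1; have D0 : is_derive t 1 (fun t : R => 1 + t) 1.
  have Dc : is_derive t 1 (cst 1 : R -> R) 0 by exact: is_derive_cst.
  by apply: (is_derive_eq (is_deriveD Dc (is_derive_id t 1))); rewrite add0r.
have t2 : 0 < 1 + t by lra.
by apply: (is_derive_eq (is_derive1_comp (is_derive1_ln t2) D0)); rewrite mulr1.
Qed.

Lemma horner_is_derive (p : {poly R}) (f : R -> R) (df x : R) :
  horner p =1 f -> p^`().[x] = df -> is_derive x 1 f df.
Proof. by move=> /funext <- <-; exact: is_derive_poly. Qed.

Lemma ln1D_le (x : R) : `|x| <= 2^-1 -> `|ln (1 + x)| <= 2 * `|x|.
Proof.
move=> x2; rewrite -[2]ger0_norm // -normrM.
apply: (@increment_le0 (fun t => ln (1 + t)) (fun t => (1 + t)^-1)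
  (fun t => 2 * t) (fun=> 2) 2^-1) => //; rewrite ?addr0 ?ln1 ?mulr0 //.
- by move=> t; rewrite ler_norml => /andP[? ?]; apply: is_derive_ln1D; lra.
- move=> t _; apply: (@horner_is_derive (2 *: 'X)) => [y|].
    by rewrite hornerZ hornerX.
  by rewrite derivZ derivX hornerZ hornerC mulr1.
- move=> t; rewrite ler_norml => /andP[? ?].
  rewrite ger0_norm; last by rewrite invr_ge0; lra.
  by rewrite invf_ple ?posrE //; lra.
Qed.

Lemma ln1D_taylor (x : R) : `|x| <= 2^-1 ->
  `|ln (1 + x) - x + x ^+ 2 / 2| <= `|x| ^+ 3.
Proof.
move=> x2; rewrite -normrX.
apply: (@increment_le0 (fun t => ln (1 + t) - t + t ^+ 2 / 2)
  (fun t => (1 + t)^-1 + (t - 1)) (fun t => t ^+ 3) (fun t => 3 * t ^+ 2) 2^-1) => //.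
- by rewrite addr0 ln1 expr0n mul0r addr0 subr0.
- by rewrite expr0n.
- move=> t; rewrite ler_norml => /andP[? ?].
  have D1 : is_derive t 1 (fun t => ln (1 + t)) (1 + t)^-1 by apply: is_derive_ln1D; lra.
  have D2 : is_derive t 1 (fun t : R => - t + t ^+ 2 / 2) (t - 1).
    apply: (@horner_is_derive (- 'X + 2^-1 *: 'X^2)) => [y|].
      by rewrite !(hornerD, hornerN, hornerZ, hornerXn, hornerX) [_^-1 * _]mulrC.
    rewrite derivD derivN derivX derivZ derivXn.
    rewrite !(hornerD, hornerN, hornerZ, hornerMn, hornerXn, hornerC) /=.
    by rewrite expr1; lra.
  rewrite [X in is_derive _ _ X](_ : _ =
    (fun t => ln (1 + t)) \+ (fun t : R => - t + t ^+ 2 / 2)); last first.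
    by apply/funext => y /=; rewrite addrA.
  exact: is_deriveD.
- move=> t _; apply: (@horner_is_derive 'X^3) => [y|]; first by rewrite hornerXn.
  by rewrite derivXn hornerMn hornerXn mulr_natl.
- move=> t; rewrite ler_norml => /andP[? ?].
  have t1 : 0 < 1 + t by lra.
  have -> : (1 + t)^-1 + (t - 1) = t ^+ 2 / (1 + t) by field; lra.
  rewrite ger0_norm ?divr_ge0 ?sqr_ge0 ?(ltW t1) // ler_pdivrMr //.
  by have := sqr_ge0 t; nra.
Qed.

Lemma expR_sub1_le (x : R) : `|x| <= 1 -> `|expR x - 1| <= 4 * `|x|.
Proof.
move=> x2; rewrite -[4]ger0_norm // -normrM.
apply: (@increment_le0 (fun t => expR t - 1) expR (fun t => 4 * t) (fun=> 4) 1) => //.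
- by rewrite expR0 subrr.
- by rewrite mulr0.
- move=> t _.
  have Dc : is_derive t 1 (cst 1 : R -> R) 0 by exact: is_derive_cst.
  by apply: (is_derive_eq (is_deriveB (is_derive_expR t) Dc)); rewrite subr0.
- move=> t _; apply: (@horner_is_derive (4 *: 'X)) => [y|].
    by rewrite hornerZ hornerX.
  by rewrite derivZ derivX hornerZ hornerC mulr1.
- move=> t; rewrite ler_norml => /andP[? ?].
  by rewrite ger0_norm ?expR_ge0 // (le_trans _ (expR_le4 R)) // ler_expR.
Qed.

(** Chernoff bound, in terms of the Poisson variable of mean [j y]: a term
[(j y)^i/i!] with [i < j] is at most [y^j j^i/i!]. *)
Lemma gamma_cdf_chernoff_right j (y : R) : 1 <= y ->
  1 - gamma_cdf j (j%:R * y) <= expR (j%:R - j%:R * y) * y ^+ j.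
Proof.
move=> y1; have y0 : 0 <= y by lra.
rewrite /gamma_cdf opprB addrC subrK addrC expRD -mulrA ler_wpM2l ?expR_ge0 //.
apply: le_trans (ler_wpM2r _ (@expR_ge_sum R j%:R j _)); rewrite ?exprn_ge0 //.
rewrite horner_poly mulr_suml; apply: ler_sum => i _.
rewrite mulrC exprMn [leRHS]mulrAC ler_wpM2r ?invr_ge0 // ler_wpM2l ?exprn_ge0 //.
by rewrite ler_weXn2l // ltnW.
Qed.

(** The tail of the exponential series at [x] from order [j] on is at most [c^-j]
times the series at [c x].  Differentiation lowers [j] by one on both sides. *)
Lemma expR_sub_poly_le j (c x : R) : 1 <= c -> 0 <= x ->
  `|expR x - (exp_poly R j).[x]| <= expR (c * x) / c ^+ j.
Proof.
move=> c1; have c0 : 0 < c by lra.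
elim: j x => [|j IHj] x x0.
  rewrite /exp_poly poly_def big_ord0 horner0 subr0 expr0 divr1.
  by rewrite ger0_norm ?expR_ge0 // ler_expR ler_peMl.
have H := @increment_le R (fun t => expR t - (exp_poly R j.+1).[t])
  (fun t => expR t - (exp_poly R j).[t]) (fun t => expR (c * t) / c ^+ j.+1)
  (fun t => expR (c * t) / c ^+ j) 0 x x0.
rewrite mulr0 expR0 horner_coef0 coef_poly /= invr1 subrr subr0 in H.
apply: le_trans (H _ _ _) _ => [t _|t _|t /andP[t0 _]|].
- by apply: (is_derive_eq (is_deriveB (is_derive_expR t) (is_derive_poly (exp_poly R j.+1) t)));
    rewrite deriv_exp_poly.
- have D1 : is_derive t 1 (fun t => c * t) c.
    apply: (@horner_is_derive (c *: 'X)) => [y|]; first by rewrite hornerZ hornerX.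
    by rewrite derivZ derivX hornerZ hornerC mulr1.
  have D2 := is_deriveZ (c ^- j.+1) (is_derive1_comp (is_derive_expR _) D1).
  rewrite [X in is_derive _ _ X](_ : _ = c ^- j.+1 *: (expR \o (fun t => c * t))); last first.
    by apply/funext => y; rewrite /= mulrC.
  apply: (is_derive_eq D2); rewrite /GRing.scale /= exprS; field.
  by rewrite expf_neq0 ?gt_eqF.
- exact: IHj.
by rewrite gerBl div1r invr_ge0 exprn_ge0 ?ltW.
Qed.

Lemma gamma_cdf_chernoff_left j (y : R) : 0 < y -> y <= 1 ->
  gamma_cdf j (j%:R * y) <= expR (j%:R - j%:R * y) * y ^+ j.
Proof.
move=> y0 y1.
have jy0 : 0 <= j%:R * y by rewrite mulr_ge0 // ltW.
have := @expR_sub_poly_le j y^-1 (j%:R * y) _ jy0.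
rewrite invf_ge1 // => /(_ y1); rewrite mulrCA mulVf ?gt_eqF // mulr1 exprVn invrK.
move=> /(le_trans (ler_norm _)) H.
rewrite addrC expRD -mulrA; apply: le_trans (ler_wpM2l _ H); rewrite ?expR_ge0 //.
by rewrite mulrBr -expRD addNr expR0.
Qed.

(** The two Chernoff bounds are Gaussian near the mean: [ln (1 + x) - x] is
[- x^2/2] up to a cubic error. *)
Lemma gamma_tail_exponent j (x : R) : `|x| <= 2^-1 ->
  expR (j%:R - j%:R * (1 + x)) * (1 + x) ^+ j
    <= expR (- (j%:R * x ^+ 2 / 2) + j%:R * `|x| ^+ 3).
Proof.
move=> x2; have := ln1D_taylor x2; move: (x2); rewrite ler_norml => /andP[? ?].
rewrite ler_norml => /andP[_ H].
rewrite -[X in X ^+ j]lnK ?posrE; last by lra.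
rewrite -expRM_natl -expRD ler_expR.
have := ler_wpM2l (ler0n R j) H; lra.
Qed.

(** An antiderivative of [(1 + u^4) gauss_pdf(u)], which is bounded: the relative
error [O((1 + u^4)/sqrt j)] on a density hence costs [O(1/sqrt j)] on the
distribution function, uniformly in the interval. *)
Definition quartic_antider (u : R) := 4 * Phi u - (u ^+ 3 + 3 * u) * gauss_pdf u.

Lemma is_derive_quartic_antider (u : R) :
  is_derive u 1 quartic_antider ((1 + u ^+ 4) * gauss_pdf u).
Proof.
have D1 := is_deriveZ 4 (is_derive_Phi u).
have D2 : is_derive u 1 (fun u : R => u ^+ 3 + 3 * u) (3 * u ^+ 2 + 3).
  apply: (@horner_is_derive ('X^3 + 3 *: 'X)) => [y|].
    by rewrite !(hornerD, hornerZ, hornerXn, hornerX).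
  rewrite derivD derivZ derivX derivXn.
  rewrite !(hornerD, hornerZ, hornerMn, hornerXn, hornerC) /=.
  ring.
apply: (is_derive_eq (is_deriveB D1 (is_deriveM D2 (is_derive_gauss_pdf u)))).
by rewrite /GRing.scale /=; ring.
Qed.

Lemma quartic_antider_bound u : `|quartic_antider u| <= 36.
Proof.
rewrite /quartic_antider; have := Phi_ge0 u; have := Phi_le1 u => P1 P0.
suff : `|(u ^+ 3 + 3 * u) * gauss_pdf u| <= 32.
  rewrite !ler_norml => /andP[? ?]; apply/andP; split; lra.
rewrite normrM (ger0_norm (gauss_pdf_ge0 u)).
apply: le_trans (ler_wpM2l (normr_ge0 _) (gauss_pdf_le u)) _.
rewrite expRN ler_pdivrMr ?expR_gt0 //.
have u2 : 0 <= u ^+ 2 / 2 by rewrite divr_ge0 ?sqr_ge0.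
have := expR_ge_sum 3 u2.
rewrite !big_ord_recl big_ord0 /= /bump /= !expr0 expr1 !divr1 addr0.
set e := expR _ => He.
have {He} : 32 + 16 * u ^+ 2 + 4 * u ^+ 4 <= 32 * e.
  apply: le_trans (ler_wpM2l (ler0n R 32) He); rewrite !addn0 (_ : (1 + 1)`!%N = 2%N) //.
  by rewrite le_eqVlt; apply/orP; left; apply/eqP; field.
move=> H; apply: le_trans H.
have := sqr_ge0 (2 * u ^+ 2 - u / 4); have := sqr_ge0 (2 * u ^+ 2 + u / 4).
have := sqr_ge0 (u - 1); have := sqr_ge0 (u + 1).
by rewrite ler_norml => h1 h2 h3 h4; apply/andP; split; nra.
Qed.

End Estimates.

(** * Central limit theorem for the Gamma distribution *)

(** [M] and [D] stand for the masses that the Gamma and Gaussian laws give to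
[[-U, U]].  Both are close to [1], so a constant [c] with [M] close to [c D] is
itself close to [1]. *)
Lemma mass_ratio_le (R : realFieldType) (c v D M : R) :
  0 < c -> 0 < v -> 2000 * v <= 1 -> 1 - 2 * v <= D <= 1 -> 1 - 8 * v <= M <= 1 ->
  `|M - c * D| <= 864 * c * v -> c <= 2 /\ `|c - 1| <= 1740 * v.
Proof.
move=> c0 v0 v1 /andP[D1 D2] /andP[M1 M2]; rewrite ler_norml => /andP[H1 H2].
have p1 : 0 <= c * (D - 1 + 2 * v) by apply: mulr_ge0; [exact: ltW | clear - D1; lra].
have p2 : 0 <= c * (1 - 2000 * v) by apply: mulr_ge0; [exact: ltW | clear - v1; lra].
have c2 : c <= 2 by clear - p1 p2 H1 M2; lra.
have p3 : 0 <= v * (2 - c) by apply: mulr_ge0; [exact: ltW | clear - c2; lra].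
have p4 : 0 <= c * (1 - D) by apply: mulr_ge0; [exact: ltW | clear - D2; lra].
split=> //; rewrite ler_norml; apply/andP; split.
  by clear - p3 p4 H2 M1 v0; lra.
by clear - p1 p3 H1 M2 v0; lra.
Qed.

(** [m] and [d] stand for the masses of [[-U, u]], and [a] and [p] for those of
[]-oo, -U[], under the two laws. *)
Lemma cdf_gap_le (R : realFieldType) (c v d m a p : R) :
  0 < v -> c <= 2 -> `|c - 1| <= 1740 * v -> 0 <= d <= 1 -> `|m - c * d| <= 864 * c * v ->
  0 <= a <= 4 * v -> 0 <= p <= v -> `|m + a - (d + p)| <= 4000 * v.
Proof.
move=> v0 c2 c1 /andP[d0 d1] H /andP[a0 a1] /andP[p0 p1].
have -> : m + a - (d + p) = (m - c * d) + (c - 1) * d + (a - p) by ring.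
have h1 : `|m - c * d| <= 1728 * v.
  by apply: le_trans H _; rewrite ler_pM2r //; clear - c2; lra.
have h2 : `|(c - 1) * d| <= 1740 * v.
  by rewrite normrM (ger0_norm d0) -[leRHS]mulr1 ler_pM.
have h3 : `|a - p| <= 4 * v.
  by rewrite ler_norml; apply/andP; split; clear - a0 a1 p0 p1 v0; lra.
apply: le_trans (ler_normD _ _) _; apply: le_trans (lerD (ler_normD _ _) h3) _.
by clear - h1 h2 v0; lra.
Qed.

Section GammaCLT.
Variables (R : realType) (k : nat).
Let J : R := k.+1%:R.
Let s : R := Num.sqrt J.

Definition std_gamma_cdf (u : R) := gamma_cdf k.+1 (k.+1%:R + u * Num.sqrt k.+1%:R).

Definition std_gamma_pdf (u : R) :=
  s * (expR (- (J + u * s)) * (J + u * s) ^+ k / k`!%:R).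

(** The constant [kappa] of the local approximation, the ratio of the standardized
Gamma density to the Gaussian density at [u = 0]. *)
Definition laplace_ratio : R :=
  s * expR (- J) * J ^+ k / k`!%:R * Num.sqrt (2 * pi).

Let s_gt0 : 0 < s.
Proof. by rewrite sqrtr_gt0 ltr0n. Qed.

Let sqr_s : s ^+ 2 = J.
Proof. by rewrite sqr_sqrtr // ler0n. Qed.

Lemma is_derive_std_gamma_cdf (u : R) : is_derive u 1 std_gamma_cdf (std_gamma_pdf u).
Proof.
have D0 : is_derive u 1 (fun u : R => J + u * s) s.
  apply: (@horner_is_derive _ (J%:P + s *: 'X)) => [y|].
    by rewrite hornerD hornerC hornerZ hornerX [s * _]mulrC.
  by rewrite derivD derivC derivZ derivX add0r hornerZ hornerC mulr1.
by apply: (is_derive_eq (is_derive1_comp (is_derive_gamma_cdf k _) D0)); rewrite mulrC.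
Qed.

Lemma laplace_ratio_gt0 : 0 < laplace_ratio.
Proof.
rewrite /laplace_ratio !mulr_gt0 ?sqrt2pi_gt0 ?expR_gt0 ?exprn_gt0 ?ltr0n //.
Qed.

(** Laplace's method: the logarithm of the ratio of [std_gamma_pdf u] to
[laplace_ratio * gauss_pdf u] is
[rho = J (ln (1 + x) - x + x^2/2) - ln (1 + x)] with [x = u / sqrt J], hence
[O((|u|^3 + |u|)/sqrt J)]. *)
Lemma std_gamma_pdf_approx u : `|u| ^+ 3 + 2 * `|u| <= s ->
  `|std_gamma_pdf u - laplace_ratio * gauss_pdf u|
    <= 12 * laplace_ratio / s * ((1 + u ^+ 4) * gauss_pdf u).
Proof.
move=> us; set x := u / s.
have uE : u = x * s by rewrite /x divfK // gt_eqF.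
have u0 := normr_ge0 u.
have nx : `|x| = `|u| / s by rewrite /x normrM normfV (gtr0_norm s_gt0).
have x2 : `|x| <= 2^-1.
  rewrite nx ler_pdivrMr //; have : 0 <= `|u| ^+ 3 by rewrite exprn_ge0.
  lra.
have /andP[x2l x2r] : - 2^-1 <= x <= 2^-1 by rewrite -ler_norml.
set rho := J * (ln (1 + x) - x + x ^+ 2 / 2) - ln (1 + x).
have rho_le : `|rho| <= (`|u| ^+ 3 + 2 * `|u|) / s.
  apply: le_trans (ler_normB _ _) _; rewrite mulrDl lerD //.
    rewrite normrM ger0_norm ?ler0n //.
    apply: le_trans (ler_wpM2l (ler0n _ _) (ln1D_taylor x2)) _.
    rewrite nx -/J -sqr_s le_eqVlt; apply/orP; left; apply/eqP; field.
    by rewrite gt_eqF.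
  by apply: le_trans (ln1D_le x2) _; rewrite nx mulrA.
have rho1 : `|rho| <= 1.
  by apply: le_trans rho_le _; rewrite ler_pdivrMr // mul1r.
have pdfE : std_gamma_pdf u = laplace_ratio * gauss_pdf u * expR rho.
  have JxE : J + u * s = J * (1 + x) by rewrite mulrDr mulr1 uE -mulrA -expr2 sqr_s mulrC.
  have E : expR (- (J + u * s)) * (1 + x) ^+ k = expR (- J) * expR (- (u ^+ 2 / 2)) * expR rho.
    rewrite -[X in X ^+ k]lnK ?posrE; last by lra.
    rewrite -expRM_natl -!expRD; congr expR.
    have kJ : k%:R = J - 1 :> R by rewrite /J -natr1 addrK.
    by rewrite kJ /rho uE exprMn sqr_s; have := sqr_s; nra.
  rewrite /std_gamma_pdf {2}JxE exprMn /laplace_ratio /gauss_pdf.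
  rewrite [expR _ * (_ * _)]mulrCA E; field.
  by rewrite gt_eqF ?sqrt2pi_gt0 // pnatr_eq0 -lt0n fact_gt0.
rewrite pdfE -[X in _ - X]mulr1 -mulrBr normrM.
have c0 : 0 <= laplace_ratio * gauss_pdf u.
  by rewrite mulr_ge0 ?gauss_pdf_ge0 // ltW // laplace_ratio_gt0.
rewrite ger0_norm //.
rewrite (_ : _ / s * _ =
  laplace_ratio * gauss_pdf u * (12 * (1 + u ^+ 4) / s)); last by ring.
rewrite ler_wpM2l //; apply: le_trans (expR_sub1_le rho1) _.
apply: le_trans (ler_wpM2l (ler0n R 4) rho_le) _.
rewrite mulrA ler_pM2r ?invr_gt0 //.
have -> : u ^+ 4 = `|u| ^+ 4 by rewrite -normrX ger0_norm // exprn_even_ge0.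
move: (`|u|) u0 => y y0.
have := sqr_ge0 (y ^+ 2 - y); have := sqr_ge0 (y - 1); have := sqr_ge0 (y ^+ 2 - 1).
nra.
Qed.

Variable U : R.
Hypotheses (U1 : 1 <= U) (sU : U ^+ 3 + 2 * U <= s) (s_big : 2000 <= s)
  (tailU : expR (- (U ^+ 2 / 2)) <= s^-1).

Let U_ge0 : 0 <= U.
Proof. exact: le_trans ler01 U1. Qed.

Let U_le_half : U <= 2^-1 * s.
Proof. by have := exprn_ge0 3 U_ge0; have := sU; lra. Qed.

Lemma std_gamma_increment a b : - U <= a -> a <= b -> b <= U ->
  `|std_gamma_cdf b - std_gamma_cdf a - laplace_ratio * (Phi b - Phi a)|
    <= 864 * laplace_ratio / s.
Proof.
move=> Ua ab bU.
have H := @increment_le R (fun u => std_gamma_cdf u - laplace_ratio * Phi u)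
  (fun u => std_gamma_pdf u - laplace_ratio * gauss_pdf u)
  (fun u => 12 * laplace_ratio / s * @quartic_antider R u)
  (fun u => 12 * laplace_ratio / s * ((1 + u ^+ 4) * gauss_pdf u)) a b ab.
have c0 : 0 <= 12 * laplace_ratio / s.
  by rewrite divr_ge0 ?ltW // mulr_gt0 // laplace_ratio_gt0.
rewrite (_ : _ - _ - _ =
  std_gamma_cdf b - laplace_ratio * Phi b -
    (std_gamma_cdf a - laplace_ratio * Phi a)); last by ring.
apply: le_trans (H _ _ _) _.
- move=> t _; exact: is_deriveB (is_derive_std_gamma_cdf t) (is_deriveZ _ (is_derive_Phi t)).
- move=> t _; exact: is_deriveZ (is_derive_quartic_antider t).
- move=> t /andP[t1 t2]; apply: std_gamma_pdf_approx; apply: le_trans sU.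
  have tU : `|t| <= U by rewrite ler_norml; apply/andP; split; lra.
  by rewrite lerD ?ler_wpM2l // lerXn2r ?nnegrE ?U_ge0.
(* An antiderivative bounded by [36] varies by at most [72]. *)
rewrite -mulrBr (_ : 864 * _ / s = 12 * laplace_ratio / s * 72); last by ring.
rewrite ler_wpM2l //.
have := @quartic_antider_bound R a; have := @quartic_antider_bound R b.
by rewrite !ler_norml => /andP[? ?] /andP[? ?]; lra.
Qed.

Let tail_exp (x : R) : `|x| = U / s ->
  expR (J - J * (1 + x)) * (1 + x) ^+ k.+1 <= 4 / s.
Proof.
move=> nx.
have x2 : `|x| <= 2^-1.
  by rewrite nx ler_pdivrMr // U_le_half.
apply: le_trans (gamma_tail_exponent k.+1 x2) _.
have xx : x ^+ 2 = (U / s) ^+ 2 by rewrite -nx -normrX ger0_norm // sqr_ge0.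
rewrite -/J xx nx expRD -sqr_s.
have -> : s ^+ 2 * (U / s) ^+ 2 / 2 = U ^+ 2 / 2 by field; rewrite gt_eqF.
rewrite mulrC ler_pM ?expR_ge0 // (le_trans _ (expR_le4 R)) // ler_expR.
have -> : s ^+ 2 * (U / s) ^+ 3 = U ^+ 3 / s by field; rewrite gt_eqF.
by rewrite ler_pdivrMr // mul1r; have := sU; have := U_ge0; lra.
Qed.

Let std_gamma_right : 1 - std_gamma_cdf U <= 4 / s.
Proof.
have E : J + U * s = J * (1 + U / s).
  by rewrite -sqr_s; field; rewrite gt_eqF.
have Us : 0 <= U / s by rewrite divr_ge0 ?U_ge0 ?ltW.
rewrite /std_gamma_cdf -/s -/J E;
apply: le_trans (@tail_exp (U / s) _); last by rewrite ger0_norm.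
by apply: gamma_cdf_chernoff_right; lra.
Qed.

Let Us_half : U / s <= 2^-1.
Proof. by rewrite ler_pdivrMr // U_le_half. Qed.

Let std_gamma_left : std_gamma_cdf (- U) <= 4 / s.
Proof.
have E : J + (- U) * s = J * (1 + - (U / s)).
  by rewrite -sqr_s; field; rewrite gt_eqF.
have Us : 0 <= U / s by rewrite divr_ge0 ?U_ge0 ?ltW.
rewrite /std_gamma_cdf -/s -/J E;
apply: le_trans (@tail_exp (- (U / s)) _); last by rewrite normrN ger0_norm.
by apply: gamma_cdf_chernoff_left; have := Us_half; lra.
Qed.

Let arg_ge0 u : - U <= u -> 0 <= J + u * s.
Proof.
move=> uU; rewrite -sqr_s expr2 -mulrDl mulr_ge0 ?(ltW s_gt0) //.
have := U_le_half; have := s_gt0; lra.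
Qed.

(** The increment over [[-U, U]] determines [laplace_ratio] up to [O(1/s)]; the
increment over [[-U, u]] then gives the value at [u]. *)
Lemma std_gamma_clt u : - U <= u -> u <= U ->
  `|std_gamma_cdf u - Phi u| <= 4000 / s.
Proof.
move=> u1 u2.
have A0 : 0 <= std_gamma_cdf (- U).
  have := @gamma_cdf_homo R k 0 _ (lexx _) (arg_ge0 (lexx (- U))).
  by rewrite gamma_cdf0.
have U0 := U_ge0.
have A1 : std_gamma_cdf U <= 1 by apply: gamma_cdf_le1; apply: arg_ge0; lra.
have Aum : std_gamma_cdf (- U) <= std_gamma_cdf u.
  by apply: gamma_cdf_homo; [apply: arg_ge0; lra | rewrite lerD2l ler_wpM2r // ltW].
have AuM : std_gamma_cdf u <= std_gamma_cdf U.
  by apply: gamma_cdf_homo; [apply: arg_ge0; lra | rewrite lerD2l ler_wpM2r // ltW].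
have P0 := Phi_ge0 (- U); have P1 := Phi_le1 U.
have PU := Phi_tail_right U1; have PN := Phi_tail_left U1.
have gU := le_trans (gauss_pdf_le U) tailU.
have Pm : Phi (- U) <= Phi u by apply: Phi_homo.
have PM : Phi u <= Phi U by apply: Phi_homo.
have I1 := @std_gamma_increment (- U) U (lexx _) _ (lexx _).
have {I1} I1 := I1 ltac:(lra).
have I2 := @std_gamma_increment (- U) u (lexx _) u1 u2.
have k0 := laplace_ratio_gt0.
have AR := std_gamma_right; have AL := std_gamma_left.
have v0 : 0 < s^-1 by rewrite invr_gt0.
have v1 : s^-1 * 2000 <= 1 by rewrite mulrC ler_pdivrMr // mul1r.
move: I1 I2 AR AL gU v0 v1 k0; move: (s^-1) laplace_ratio => v c.
move: (std_gamma_cdf U) (std_gamma_cdf (- U)) (std_gamma_cdf u) A0 A1 Aum AuM.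
move=> AU AN Au A0 A1 Aum AuM.
move: P0 P1 PU PN Pm PM.
move: (Phi U) (Phi (- U)) (Phi u) (gauss_pdf U) => PU PN Pu g P0 P1 HPU HPN Pm PM.
move=> I1 I2 AR AL gU v0 v1 c0.
have Dm : 1 - 2 * v <= PU - PN <= 1 by apply/andP; split; lra.
have Mm : 1 - 8 * v <= AU - AN <= 1 by apply/andP; split; lra.
rewrite mulrC in v1.
have [c2 c1] := mass_ratio_le c0 v0 v1 Dm Mm I1.
have dm : 0 <= Pu - PN <= 1.
  by rewrite subr_ge0 Pm lerBlDr (le_trans (le_trans PM P1)) // lerDl.
have am : 0 <= AN <= 4 * v by rewrite A0.
have pm : 0 <= PN <= v by rewrite P0 (le_trans HPN).
have -> : Au - Pu = (Au - AN) + AN - ((Pu - PN) + PN) by ring.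
exact: cdf_gap_le v0 c2 c1 dm I2 am pm.
Qed.

End GammaCLT.

(** * Smallest cycles *)

(** In a sorted list the entries at most [m] come first. *)
Lemma sorted_nth_le (L : seq nat) m k : sorted leq L ->
  ((k < size L) && (nth 0 L k <= m))%N = (k < count (fun l => l <= m) L)%N.
Proof.
elim: L k => [|a L IHL] k //= aL.
have count0 : (m < a)%N -> count (fun l => l <= m)%N L = 0%N.
  move=> ma; apply/eqP; rewrite -leqn0 leqNgt -has_count; apply/hasPn => l lL.
  rewrite -ltnNge (leq_trans ma) //.
  by have /allP/(_ l lL) := order_path_min leq_trans aL.
case: k => [|k] /=; rewrite ?ltnS.
  by case: (leqP a m) => am //=; rewrite count0.
rewrite IHL ?(path_sorted aL) //.
by case: (leqP a m) => am //=; rewrite count0.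
Qed.

Section Assembly.
Variable R : realType.

Lemma nth_smallest_cycle_le n m k (s : 'S_n) :
  ((k < size (cycle_lengths s)) && (nth_smallest_cycle k.+1 s <= m))%N
  = (k < small_cycles m s [set: 'I_n])%N.
Proof.
rewrite /nth_smallest_cycle sorted_nth_le ?(sort_sorted leq_total) //.
rewrite /cycle_lengths count_sort count_map -sum1_count big_enum_cond /= sum1dep_card.
congr (_ < _)%N; apply: eq_card => c; rewrite !inE.
by rewrite finset.subsetT.
Qed.

Lemma ln_nat_le (l : nat) (x : R) : (0 < l)%N ->
  (ln l%:R <= x) = (l <= Num.truncn (expR x))%N.
Proof.
move=> l0; rewrite truncn_ge_nat ?expR_ge0 // -[in RHS](@lnK R l%:R) ?ler_expR //.
by rewrite posrE ltr0n.
Qed.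

Lemma log_cycle_leE n k (x : R) (s : 'S_n) :
  log_cycle_le k.+1 x s = (k < small_cycles (Num.truncn (expR x)) s [set: 'I_n])%N.
Proof.
rewrite -nth_smallest_cycle_le /log_cycle_le; apply: andb_id2l => ks.
apply: ln_nat_le; rewrite /nth_smallest_cycle.
have : nth 0%N (cycle_lengths s) k \in cycle_lengths s by rewrite mem_nth.
rewrite mem_sort => /mapP[c]; rewrite mem_enum => /imsetP[z _ ->] ->.
by rewrite lt0n card_porbit_neq0.
Qed.

Lemma uniform_perm_probE n k (x : R) :
  uniform_perm_prob R (log_cycle_le (n := n) k.+1 x) =
  cycle_count_prob R n (Num.truncn (expR x)) k.
Proof.
rewrite /uniform_perm_prob /cycle_count_prob; congr (_ / _).
  rewrite -sum1_card natr_sum big_mkcond; apply: eq_bigr => s _.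
  by rewrite -topredE /= log_cycle_leE; case: ifP.
by rewrite -card_Sn; congr (_%:R); apply: eq_card => s; rewrite !inE.
Qed.

Lemma uniform_perm_prob_bounds n (E : {pred 'S_n}) : 0 <= uniform_perm_prob R E <= 1.
Proof.
rewrite /uniform_perm_prob divr_ge0 //=.
have : (0 < #|{: 'S_n}|)%N by apply/card_gt0P; exists 1%g.
by move=> S0; rewrite ler_pdivrMr ?ltr0n // mul1r ler_nat max_card.
Qed.

Lemma uniform_perm_prob_homo n j (x y : R) : x <= y ->
  uniform_perm_prob R (log_cycle_le (n := n) j x) <=
  uniform_perm_prob R (log_cycle_le (n := n) j y).
Proof.
move=> xy; rewrite ler_wpM2r ?invr_ge0 // ler_nat subset_leq_card //.
by apply/fintype.subsetP => s /andP[js lx]; apply/andP; split; rewrite ?(le_trans lx).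
Qed.

Lemma harmonic_sumS m : harmonic_sum R m.+1 = harmonic_sum R m + m.+1%:R^-1.
Proof. by rewrite /harmonic_sum big_nat_recr. Qed.

Lemma harmonic_sum_ge_ln m : ln m.+1%:R <= harmonic_sum R m.
Proof.
elim: m => [|m IHm]; first by rewrite ln1 /harmonic_sum big_geq.
rewrite harmonic_sumS; have m0 : 0 < m.+1%:R :> R by rewrite ltr0n.
have -> : m.+2%:R = m.+1%:R * (1 + m.+1%:R^-1) :> R.
  by rewrite mulrDr mulr1 divff ?gt_eqF // natr1.
have v0 : 0 < m.+1%:R^-1 :> R by rewrite invr_gt0.
rewrite lnM ?posrE ?addr_gt0 //.
by rewrite lerD // le_ln1Dx // (lt_trans _ v0).
Qed.

Lemma harmonic_sum_le_ln m : harmonic_sum R m.+1 <= 1 + ln m.+1%:R.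
Proof.
elim: m => [|m IHm].
  by rewrite harmonic_sumS /harmonic_sum big_geq // ln1 invr1 add0r addr0.
rewrite harmonic_sumS; have m0 : 0 < m.+2%:R :> R by rewrite ltr0n.
have v0 : 0 < m.+2%:R^-1 :> R by rewrite invr_gt0.
have v1 : m.+2%:R^-1 < 1 :> R by rewrite invf_lt1 // ltr1n.
have E : m.+1%:R = m.+2%:R * (1 + - m.+2%:R^-1) :> R.
  by rewrite mulrDr mulr1 mulrN divff ?gt_eqF // -[m.+2%:R]natr1 addrK.
have H : ln m.+1%:R <= ln m.+2%:R - m.+2%:R^-1 :> R.
  rewrite E lnM ?posrE ?subr_gt0 //.
  by rewrite lerD2l le_ln1Dx // ltrN2.
by apply: le_trans (lerD IHm (lexx _)) _; rewrite -addrA lerD2l -lerBrDr.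
Qed.

(** The loss of [1] is harmless: it moves the argument of the Gamma law by
one unit, that is by [1/sqrt j] standard deviations. *)
Lemma harmonic_sum_truncn_exp (x : R) : 0 <= x ->
  x <= harmonic_sum R (Num.truncn (expR x)) <= x + 1.
Proof.
move=> x0; set m := Num.truncn _.
have /andP[m1 m2] : m%:R <= expR x < m.+1%:R by by apply: truncn_itv; rewrite expR_ge0.
have m0 : (0 < m)%N by rewrite truncn_gt0 -expR0 ler_expR.
have := harmonic_sum_ge_ln m; have := harmonic_sum_le_ln m.-1; rewrite prednK // => h1 h2.
apply/andP; split.
  apply: le_trans h2; rewrite -[leLHS]expRK ler_ln ?posrE ?expR_gt0 ?ltr0n //.
  exact: ltW.
apply: le_trans h1 _; rewrite addrC lerD2r -[leRHS]expRK ler_ln ?posrE ?expR_gt0 ?ltr0n //.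
Qed.

(** Large [j = k.+1].  With [l = sqrt (ln J)] one has [s = sqrt J = exp (l^2/2)],
so that [l >= 10] makes [s] larger than all the polynomials in [l] that occur. *)
Section Large.
Variables (n k : nat).
Let J : R := k.+1%:R.
Let s : R := Num.sqrt J.
Let l : R := Num.sqrt (ln J).
Let w0 : R := l - l^-1.
Hypothesis (J_big : expR 100 <= J).
Hypothesis (J_le : J <= ln n%:R - Num.sqrt (ln n%:R * ln (ln n%:R))).
Hypothesis (n3 : (3 <= n)%N).

Let J_gt0 : 0 < J. Proof. by rewrite ltr0n. Qed.

Let lnJ : 100 <= ln J.
Proof. by rewrite -[leLHS]expRK ler_ln ?posrE ?expR_gt0. Qed.

Let sqr_l : l ^+ 2 = ln J.
Proof. by rewrite sqr_sqrtr // (le_trans _ lnJ). Qed.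

Let l_ge10 : 10 <= l.
Proof.
have -> : 10 = Num.sqrt (10 ^+ 2) :> R by rewrite sqrtr_sqr ger0_norm.
by rewrite ler_wsqrtr // (le_trans _ lnJ) // -natrX.
Qed.

Let sE : s = expR (l ^+ 2 / 2).
Proof.
rewrite sqr_l; apply/eqP; rewrite -(@eqrXn2 _ 2) ?sqrtr_ge0 ?expR_ge0 //.
rewrite sqr_sqrtr ?ltW // -expRM_natl mulrCA divff ?mulr1 ?pnatr_eq0 //.
by rewrite lnK ?posrE.
Qed.

Let s_ge : 260 * l ^+ 3 <= s.
Proof.
have l0 : 0 <= l by have := l_ge10; lra.
have h : 0 <= l ^+ 2 / 2 by rewrite divr_ge0 ?exprn_ge0.
(* The term of degree [4] of the exponential series at [l ^ 2 / 2] is enough. *)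
rewrite sE; apply: le_trans (expR_ge1Dxn 3 h).
have -> : (l ^+ 2 / 2) ^+ 4 / 4`!%:R = l ^+ 3 * (l ^+ 5 / 384).
  have -> : 4`!%:R = 24 :> R by [].
  by field.
have : 10 ^+ 5 <= l ^+ 5 by rewrite lerXn2r ?nnegrE ?l_ge10.
move: (l ^+ 5) => y hy.
have : l ^+ 3 * 260 <= l ^+ 3 * (y / 384) by rewrite ler_wpM2l ?exprn_ge0 //; lra.
lra.
Qed.

Let l3_ge : 100 * l <= l ^+ 3.
Proof.
have := l_ge10 => l10; have -> : l ^+ 3 = l ^+ 2 * l by rewrite exprSr.
rewrite ler_wpM2r; [by []|lra|].
by rewrite sqr_l lnJ.
Qed.

Let s_big : 2000 <= s.
Proof. by have := s_ge; have := l3_ge; have := l_ge10; lra. Qed.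

Let s_gt0 : 0 < s. Proof. by have := s_big; lra. Qed.

Let sqr_s : s ^+ 2 = J. Proof. by rewrite sqr_sqrtr ?ltW. Qed.

Let sU : (l + 1) ^+ 3 + 2 * (l + 1) <= s.
Proof.
have := s_ge; have := l3_ge; have := l_ge10 => h1 h2 h3.
have h4 : 10 * l ^+ 2 <= l ^+ 3.
  have -> : l ^+ 3 = l * l ^+ 2 by rewrite exprS.
  by rewrite ler_wpM2r ?sqr_ge0.
have -> : (l + 1) ^+ 3 + 2 * (l + 1) = l ^+ 3 + 3 * l ^+ 2 + 5 * l + 3 by ring.
move: h1 h2 h3 h4; lra.
Qed.

Let expNl : expR (- (l ^+ 2 / 2)) = s^-1.
Proof. by rewrite expRN -sE. Qed.

Let tailU : expR (- ((l + 1) ^+ 2 / 2)) <= s^-1.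
Proof.
rewrite -expNl ler_expR lerN2 ler_pM2r ?invr_gt0 // lerXn2r ?nnegrE ?lerDl //;
  by have := l_ge10; lra.
Qed.

Let linv : 0 < l^-1 <= 1 / 10.
Proof.
have l0 : 0 < l by have := l_ge10; lra.
by rewrite invr_gt0 l0 /= -[1 / 10]invrK lef_pV2 ?posrE ?invrK ?l0 // invf_div divr1 l_ge10.
Qed.

Let std_clt (w : R) : - w0 <= w -> w <= w0 + s^-1 ->
  `|std_gamma_cdf k w - Phi w| <= 4000 / s.
Proof.
have := l_ge10; have /andP[? ?] := linv.
have : s^-1 <= 1 by rewrite invf_le1 //; have := s_big; lra.
rewrite /w0 => *; apply: (@std_gamma_clt _ _ (l + 1)); rewrite -/J -/s //; lra.
Qed.

(** This is where the range of [j] and the choice of [w0] are used: [w0 s] falls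
short of [l s] by [s / l], which exceeds [ln (25 J)]. *)
Let n_ge (w : R) : w <= w0 ->
  (25 * k.+1 * Num.truncn (expR (J + w * s)) <= n)%N.
Proof.
move=> ww; have n0 : (0 < n)%N by case: n n3.
rewrite -(ler_nat R) !natrM; set m := Num.truncn _.
have m1 : m%:R <= expR (J + w * s) by rewrite truncn_le // expR_ge0.
apply: le_trans (ler_wpM2l _ m1) _; first by rewrite mulr_ge0.
have L0 : J <= ln n%:R by apply: le_trans J_le _; rewrite gerBl sqrtr_ge0.
have LL : s * l <= Num.sqrt (ln n%:R * ln (ln n%:R)).
  have -> : s * l = Num.sqrt (J * ln J) by rewrite sqrtrM // ltW.
  rewrite ler_wsqrtr // ler_pM ?(ltW J_gt0) ?(le_trans _ lnJ) //.
  by rewrite ler_ln ?posrE // (lt_le_trans J_gt0).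
(* The choice of [w0] leaves a factor [exp (s / l)], which has to exceed [25 J]. *)
have J25 : ln (25 * J) <= s * l^-1.
  rewrite lnM ?posrE // -sqr_l.
  have l0 : 0 < l by have := l_ge10; lra.
  rewrite ler_pdivlMr //.
  have l25 : ln 25 <= 25 :> R by apply/ltW/ln_sublinear.
  apply: (@le_trans _ _ ((25 + l ^+ 2) * l)).
    by rewrite ler_wpM2r ?lerD2r // ltW.
  have -> : (25 + l ^+ 2) * l = 25 * l + l ^+ 3 by ring.
  by have := s_ge; have := l3_ge; move: l0; lra.
have ws : w * s <= s * l - s * l^-1.
  by rewrite -mulrBr mulrC ler_wpM2l ?(ltW s_gt0).
have -> : n%:R = expR (ln n%:R) :> R by rewrite lnK // posrE ltr0n.
rewrite -[25 * J](@lnK R) ?posrE ?mulr_gt0 // -expRD ler_expR.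
by have := J_le; move: LL J25 ws; lra.
Qed.

(** [exp (12 J) <= 4^(12 J) = 2^(24 J)], whence the order [25 J] of truncation. *)
Let geometric_le (h : R) : h <= 3 * J ->
  2 * (2 ^- (25 * k.+1) * expR (4 * h)) <= 2 / s.
Proof.
move=> hJ; rewrite ler_pM2l //.
have e1 : expR (4 * h) <= 2 ^+ (24 * k.+1).
  apply: (@le_trans _ _ (expR ((12 * k.+1)%:R * 1))).
    by rewrite ler_expR mulr1 natrM -/J; move: hJ; lra.
  have -> : (24 * k.+1 = 2 * (12 * k.+1))%N by rewrite mulnA.
  rewrite expRM_natl [leRHS]exprM.
  rewrite lerXn2r ?nnegrE ?expR_ge0 ?exprn_ge0 // (le_trans (expR_le4 R)) //.
  by rewrite -natrX.
apply: le_trans (ler_wpM2l _ e1) _; first by rewrite invr_ge0 exprn_ge0.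
have -> : (25 * k.+1 = k.+1 + 24 * k.+1)%N by rewrite -mulSn.
rewrite exprD invfM -mulrA mulVf ?mulr1 ?expf_neq0 // lef_pV2 ?posrE ?exprn_gt0 //.
apply: (@le_trans _ _ J); last by rewrite -natrX ler_nat ltnW // ltn_expl.
by rewrite -sqr_s expr2 ler_peMl ?(ltW s_gt0) //; have := s_big; lra.
Qed.

(** The mean [h] lies between [J + w s] and [J + w s + 1 = J + (w + 1/s) s], so the
Gamma distribution function at [h] lies between the standardized one at [w] and
at [w + 1/s], and [Phi] varies by at most [1/s] between these points. *)
Lemma prob_close_center (w : R) : - w0 <= w -> w <= w0 ->
  `|cycle_count_prob R n (Num.truncn (expR (J + w * s))) k - Phi w| <= 4003 / s.
Proof.
move=> w1 w2; set x := J + w * s; set m := Num.truncn _.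
have ws : w * s <= J.
  rewrite -sqr_s expr2 ler_pM2r //; apply: le_trans w2 _.
  have /andP[? ?] := linv; have := sU; have := l_ge10; rewrite /w0 => ? h.
  have : 0 <= (l + 1) ^+ 3 by rewrite exprn_ge0 //; lra.
  lra.
have sw : - J <= w * s.
  rewrite -sqr_s expr2 -mulNr ler_pM2r //; apply: le_trans w1.
  have /andP[? ?] := linv; have := sU; have := l_ge10; rewrite /w0 => ? h.
  have : 0 <= (l + 1) ^+ 3 by rewrite exprn_ge0 //; lra.
  lra.
have x0 : 0 <= x by rewrite /x; lra.
have J1 : 1 <= J by rewrite ler1n.
have /andP[h1 h2] := harmonic_sum_truncn_exp x0.
have kr : (k <= 25 * k.+1)%N by rewrite (leq_trans (leqnSn k)) // leq_pmull.
have P1 := cycle_count_prob_gamma R (n_ge w2) kr; rewrite -/x -/m in P1.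
have {P1} P1 := le_trans P1 (geometric_le (_ : harmonic_sum R m <= 3 * J)).
have {P1} P1 := P1 ltac:(move: h2; rewrite /x; lra).
have G1 : std_gamma_cdf k w <= gamma_cdf k.+1 (harmonic_sum R m).
  exact: gamma_cdf_homo.
have G2 : gamma_cdf k.+1 (harmonic_sum R m) <= std_gamma_cdf k (w + s^-1).
  have -> : std_gamma_cdf k (w + s^-1) = gamma_cdf k.+1 (x + 1).
    by rewrite /std_gamma_cdf mulrDl -/J -/s mulVf ?gt_eqF // addrA.
  by apply: gamma_cdf_homo => //; apply: le_trans x0 h1.
have v0 : 0 < s^-1 by rewrite invr_gt0.
have wv : w <= w + s^-1 by rewrite lerDl ltW.
have C1 := std_clt w1 (le_trans wv (lerD w2 (lexx _))).
have C2 := std_clt (le_trans w1 wv) (lerD w2 (lexx _)).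
have L := Phi_lip wv.
clear w1 w2 ws sw x0 J1 h1 h2 kr wv.
move: P1 G1 G2 v0 C1 C2 L.
have -> : w + s^-1 - w = s^-1 by rewrite addrAC subrr add0r.
move: (std_gamma_cdf k w) (std_gamma_cdf k (w + s^-1)) => A A'.
move: (gamma_cdf k.+1 _) (cycle_count_prob R n m k) (Phi w) (Phi (w + s^-1)) => G P F F'.
move: (s^-1) => v.
rewrite !ler_norml => /andP[? ?] ? ? ? /andP[? ?] /andP[? ?] ?.
by apply/andP; split; lra.
Qed.

(** Beyond [w0] both distribution functions are monotone and already within
[O(1/s)] of their limits. *)
Lemma prob_close (w : R) :
  `|uniform_perm_prob R (log_cycle_le (n := n) k.+1 (J + w * s)) - Phi w| <= (4003 + 4) / s.
Proof.
have w0_ge1 : 1 <= w0.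
  by have /andP[? ?] := linv; have := l_ge10; rewrite /w0; lra.
(* [w0 ^ 2 >= l ^ 2 - 2], and [exp (- l ^ 2 / 2)] is [1 / s]. *)
have tail : gauss_pdf w0 <= 4 / s.
  apply: le_trans (gauss_pdf_le _) _; rewrite -expNl.
  apply: le_trans (ler_wpM2r (expR_ge0 _) (expR_le4 R)).
  rewrite -expRD ler_expR /w0.
  have l0 : l != 0 by rewrite gt_eqF //; have := l_ge10; lra.
  have -> : (l - l^-1) ^+ 2 = l ^+ 2 - 2 + l ^- 2 by field.
  have : 0 <= l ^- 2 by rewrite invr_ge0 sqr_ge0.
  lra.
have mono w1 w2 : w1 <= w2 ->
    uniform_perm_prob R (log_cycle_le (n := n) k.+1 (J + w1 * s))
    <= uniform_perm_prob R (log_cycle_le (n := n) k.+1 (J + w2 * s)).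
  by move=> ww; apply: uniform_perm_prob_homo; rewrite lerD2l ler_wpM2r // ltW.
have v0 : 0 < s^-1 by rewrite invr_gt0.
have /andP[p0 p1] := uniform_perm_prob_bounds (log_cycle_le (n := n) k.+1 (J + w * s)).
case: (lerP w0 w) => ww.
  have := mono _ _ ww; rewrite uniform_perm_probE => P1.
  have := @prob_close_center w0 ltac:(lra) (lexx _); have := Phi_tail_right w0_ge1.
  have := Phi_homo ww; have := Phi_le1 w; move: P1 p0 p1 tail v0.
  move: (cycle_count_prob _ _ _ _) (uniform_perm_prob _ _) (Phi w) (Phi _) (gauss_pdf _) (s^-1).
  move=> P Q F F' g v; rewrite !ler_norml => ? ? ? ? ? ? ? ? /andP[? ?].
  by apply/andP; split; lra.
case: (lerP w (- w0)) => ww'.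
  have := mono _ _ ww'; rewrite [X in _ <= X -> _]uniform_perm_probE => P1.
  have := @prob_close_center (- w0) (lexx _) ltac:(lra); have := Phi_tail_left w0_ge1.
  have := Phi_homo ww'; have := Phi_ge0 w; move: P1 p0 p1 tail v0.
  move: (cycle_count_prob _ _ _ _) (uniform_perm_prob _ _) (Phi w) (Phi _) (gauss_pdf _) (s^-1).
  move=> P Q F F' g v; rewrite !ler_norml => ? ? ? ? ? ? ? ? /andP[? ?].
  by apply/andP; split; lra.
rewrite uniform_perm_probE; apply: le_trans (prob_close_center (ltW ww') (ltW ww)) _.
by rewrite ler_pM2r // lerDl.
Qed.

End Large.
End Assembly.

Theorem theorem1p23 (R : realType) :
  exists C : R, forall (n j : nat) (w : R),
    (3 <= n)%N ->
    (1 <= j)%N ->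
    j%:R <= ln n%:R - Num.sqrt (ln n%:R * ln (ln n%:R)) :> R ->
    `| uniform_perm_prob R (log_cycle_le (n := n) j (j%:R + w * Num.sqrt j%:R))
       - Phi w |
      <= C * (ln (2 * j%:R) / Num.sqrt j%:R).
Proof.
have ln2 : 0 < ln 2 :> R by rewrite ln_gt0 // ltr1n.
(* The two requirements on [K] are for [j >= exp 100] and for [j < exp 100]: in
   the latter case [s <= exp 50], and the distance is at most [1]. *)
have [K [K_large K_small]] : exists K : R, 4003 + 4 <= K /\ expR 50 <= K.
  exists (4003 + 4 + expR 50); split; first by rewrite lerDl expR_ge0.
  by rewrite lerDr -natrD ler0n.
exists (K / ln 2) => n [//|k] w n3 _ kn.
set s := Num.sqrt _; set D := `|_|.
have s0 : 0 < s by rewrite sqrtr_gt0 ltr0n.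
have K0 : 0 <= K := le_trans (expR_ge0 _) K_small.
suff H : D <= K / s.
  apply: le_trans H _; rewrite mulrA ler_pM2r ?invr_gt0 // -mulrA ler_peMr //.
  rewrite mulrC ler_pdivlMr // mul1r ler_ln ?posrE // ?mulr_gt0 ?ltr0n //.
  by rewrite ler_peMr // ler1n.
have [Jbig|/ltW Jbig] := leP (expR 100 : R) k.+1%:R.
  have H := prob_close Jbig kn n3 w; apply: le_trans H _.
  by rewrite ler_pM2r ?invr_gt0.
have D1 : D <= 1.
  have /andP[p0 p1] := uniform_perm_prob_bounds R (log_cycle_le (n := n) k.+1 (k.+1%:R + w * s)).
  rewrite /D ler_norml; have := Phi_ge0 w; have := Phi_le1 w.
  by move: p0 p1; clear; move=> *; apply/andP; split; lra.
apply: le_trans D1 _; rewrite ler_pdivlMr // mul1r; apply: le_trans K_small.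
rewrite -(@ler_pXn2r _ 2) ?nnegrE ?expR_ge0 ?(ltW s0) // sqr_sqrtr // -expRM_natl.
by apply: le_trans Jbig _; rewrite ler_expR -natrM.
Qed.
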